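(* Let $n\ge 1$ and let $\lambda$ be a first layer quasi-dominant weight in type $A_n$. Then $$\langle 1,\mathcal{Q}_\lambda\rangle_t=t^{\mathrm{ht}(\lambda)},$$ where $\mathcal{Q}_\lambda$ is the fundamental quasisymmetric function indexed by $\lambda$ and $\langle\cdot,\cdot\rangle_t$ is the (degenerate) Cherednik scalar product.
   Context: Type $A_n$ conventions: $\varepsilon_1,\dots,\varepsilon_{n+1}$ is the standard basis of $\mathbb{R}^{n+1}$ with its canonical scalar product $(\cdot,\cdot)$; roots $R=\{\varepsilon_i-\varepsilon_j\}_{i\ne j}$, positive roots $R^+=\{\varepsilon_i-\varepsilon_j\}_{i<j}$, simple roots $\alpha_i=\varepsilon_i-\varepsilon_{i+1}$ ($1\le i\le n$). The root lattice is $Q=\{\lambda\in\mathbb{Z}^{n+1}:\sum_i\lambda_i=0\}$; ''weight'' means element of $Q$. $S_{n+1}$ acts by permuting coordinates, $s_i$ being the transposition of coordinates $i,i+1$. The height of a weight is $\mathrm{ht}(\lambda)=(\lambda,\rho)$ with $\rho=\frac12\sum_{\alpha\in R^+}\alpha$ (equivalently, the sum of the coefficients of $\lambda$ in the basis of simple roots). A weight is first layer if its smallest coordinate is $-1$ or if it is $0$. Its co-length is the number of its negative coordinates (all equal to $-1$). Scalar product: let $\mathbb{F}=\mathbb{Q}(t)$, let $e^\lambda$ ($\lambda\in Q$) be the characters of the compact torus $T$ with character lattice $Q$, with $1=e^0$, and let $ds$ be the Haar measure of volume one on $T$ (so $\int_T e^\lambda ds=\delta_{\lambda,0}$). Put $C(t)=\prod_{\alpha\in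 R^+}\frac{1-e^\alpha}{1-te^\alpha}$ (for $|t|$ small, a continuous function on $T$; equivalently expand in powers of $t$ for formal $t$). Let $\overline{e^\lambda}=e^{-\lambda}$, extended $\mathbb{F}$-linearly. For $f,g\in\mathbb{F}[Q]$, $\langle f,g\rangle_t=\int_T f\,\overline{g}\,C(t)\,ds$. Local action of $S_{n+1}$ on $Q$: it is determined by $s_i\bullet\lambda=\lambda$ if $\lambda_i,\lambda_{i+1}\ge 0$, and $s_i\bullet\lambda=s_i(\lambda)$ otherwise. Its orbits are called local orbits. A first layer weight is quasi-dominant if it is the (unique) maximal height element of its local orbit (its negative coordinates are then the last ones). For first layer quasi-dominant $\lambda$, the quasisymmetric monomial is $\mathcal{M}_\lambda=\sum_{\mu\in S_{n+1}\bullet\lambda}e^\mu$. Canonical expression: if $\lambda$ is first layer quasi-dominant of co-length $N\ge1$, there is a unique positive root $\beta_N$ of smallest possible height such that $\lambda-\beta_N$ has co-length $N-1$ (explicitly $\beta_N=\varepsilon_i-\varepsilon_{n+2-N}$ with $i$ the position of the rightmost positive coordinate of $\lambda$), and $\lambda-\beta_N$ is again quasi-dominant; iterating gives the canonical expression $\lambda=\beta_1+\cdots+\beta_N$, where $\lambda-\beta_N=\beta_1+\cdots+\beta_{N-1}$ is the canonical expression of $\lambda-\beta_N$. The height set is $\mathrm{Ht}(\lambda)=\{\mathrm{ht}(\beta_1),\dots,\mathrm{ht}(\beta_N)\}\subseteq\{1,\dots,n\}$, with $\mathrm{Ht}(0)=\emptyset$. For first layer quasi-dominant weights write $\mu\subseteq\lambda$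 iff $\mathrm{Ht}(\mu)\subseteq\mathrm{Ht}(\lambda)$. The fundamental quasisymmetric function is $\mathcal{Q}_\lambda=\sum_{\mu\subseteq\lambda}\mathcal{M}_\mu$, the sum over first layer quasi-dominant $\mu$. *)

(* Defs.v *)
From HB Require Import structures.
From mathcomp Require Import all_boot all_order all_algebra.
From mathcomp Require Import perm finmap.
From mathcomp Require Import boolp classical_sets functions cardinality fsbigop.
From mathcomp Require Import monalg zify.

Set Implicit Arguments.
Unset Strict Implicit.
Unset Printing Implicit Defensive.

Import Order.TTheory GRing.Theory Num.Theory.

Local Open Scope ring_scope.

Reserved Notation "{ 'fps' R }" (format "{ 'fps'  R }").

Record fps (R : Type) := Fps { fcoef : nat -> R }.
Notation "{ 'fps' R }" := (fps R) : type_scope.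

HB.instance Definition _ (R : Type) := gen_eqMixin {fps R}.
HB.instance Definition _ (R : Type) := gen_choiceMixin {fps R}.

Lemma fpsP (R : Type) (f g : {fps R}) : fcoef f =1 fcoef g -> f = g.
Proof. by case: f g => f [g] /= /funext ->. Qed.

Section FpsRing.
Variable R : comNzRingType.
Implicit Types f g h : {fps R}.

Definition fps_zero : {fps R} := Fps (fun=> 0).
Definition fps_opp f := Fps (fun k => - fcoef f k).
Definition fps_add f g := Fps (fun k => fcoef f k + fcoef g k).
Definition fpsC (c : R) : {fps R} := Fps (fun k => if k is 0 then c else 0).
Definition fps_mul f g :=
  Fps (fun k => \sum_(j < k.+1) fcoef f j * fcoef g (k - j)).

Fact fps_addA : associative fps_add.
Proof. by move=> f g h; apply: fpsP => k /=; rewrite addrA. Qed.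
Fact fps_addC : commutative fps_add.
Proof. by move=> f g; apply: fpsP => k /=; rewrite addrC. Qed.
Fact fps_add0 : left_id fps_zero fps_add.
Proof. by move=> f; apply: fpsP => k /=; rewrite add0r. Qed.
Fact fps_addN : left_inverse fps_zero fps_opp fps_add.
Proof. by move=> f; apply: fpsP => k /=; rewrite addNr. Qed.

HB.instance Definition _ :=
  GRing.isZmodule.Build {fps R} fps_addA fps_addC fps_add0 fps_addN.

Let trunc m f : {poly R} := \poly_(i < m) fcoef f i.

Let truncM m k f g : (k < m)%N -> (trunc m f * trunc m g)`_k = fcoef (fps_mul f g) k.
Proof.
move=> km; rewrite coefM; apply: eq_bigr => j _; rewrite !coef_poly.
have jm : (j < m)%N by apply: leq_ltn_trans km; rewrite -ltnS.
by rewrite jm (leq_ltn_trans (leq_subr _ _) km).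
Qed.

Let trunc_coefM m k f (p q : {poly R}) : (k < m)%N ->
  (forall i, (i < m)%N -> p`_i = q`_i) ->
  forall r : {poly R}, (p * r)`_k = (q * r)`_k.
Proof.
move=> km epq r; rewrite !coefM; apply: eq_bigr => j _.
by rewrite epq //; apply: leq_ltn_trans km; rewrite -ltnS.
Qed.

Fact fps_mulC : commutative fps_mul.
Proof.
by move=> f g; apply: fpsP => k; rewrite -!(truncM (m := k.+1)) // mulrC.
Qed.

Fact fps_mulA : associative fps_mul.
Proof.
move=> f g h; apply: fpsP => k; rewrite -!(truncM (m := k.+1)) //.
have E u v i : (i < k.+1)%N ->
    (trunc k.+1 (fps_mul u v))`_i = (trunc k.+1 u * trunc k.+1 v)`_i.
  by move=> ik; rewrite coef_poly ik truncM.
rewrite mulrC (trunc_coefM f (leqnn k.+1) (E g h)) // mulrC.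
by rewrite (trunc_coefM f (leqnn k.+1) (E f g)) // mulrA.
Qed.

Fact fps_mul1 : left_id (fpsC 1) fps_mul.
Proof.
move=> f; apply: fpsP => k /=; rewrite big_ord_recl /= mul1r subn0 big1 ?addr0 //.
by move=> i _; rewrite mul0r.
Qed.

Fact fps_mulDl : left_distributive fps_mul fps_add.
Proof.
move=> f g h; apply: fpsP => k /=; rewrite -big_split /=.
by apply: eq_bigr => i _; rewrite mulrDl.
Qed.

Fact fps_1neq0 : fpsC 1 != 0.
Proof.
by apply/eqP => /(congr1 (fun f => fcoef f 0)) /= /eqP; rewrite oner_eq0.
Qed.

HB.instance Definition _ := GRing.Zmodule_isComNzRing.Build {fps R}
  fps_mulA fps_mulC fps_mul1 fps_mulDl fps_1neq0.

(* Invertibility is decided and inverses are chosen classically. *)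
Definition fps_unit : pred {fps R} := fun f => `[< exists g, g * f = 1 >].
Definition fps_inv f : {fps R} :=
  if pselect (exists g, g * f = 1) is left ex then projT1 (cid ex) else f.

Fact fps_mulV : {in fps_unit, left_inverse 1 fps_inv *%R}.
Proof.
move=> f /asboolP ex; rewrite /fps_inv.
by case: pselect => // ex'; case: cid.
Qed.
Fact fps_unitP f g : g * f = 1 -> fps_unit f.
Proof. by move=> gf1; apply/asboolP; exists g. Qed.
Fact fps_inv0id : {in [predC fps_unit], fps_inv =1 id}.
Proof.
move=> f; rewrite inE => /asboolPn nex; rewrite /fps_inv.
by case: pselect.
Qed.

HB.instance Definition _ := GRing.ComNzRing_hasMulInverse.Build {fps R}
  fps_mulV fps_unitP fps_inv0id.

Definition fpsX : {fps R} := Fps (fun k => (k == 1%N)%:R).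

Definition fps_of_poly (p : {poly R}) : {fps R} := Fps (fun k => p`_k).

Lemma fcoefD f g k : fcoef (f + g) k = fcoef f k + fcoef g k.
Proof. by []. Qed.
Lemma fcoefM f g k : fcoef (f * g) k = \sum_(j < k.+1) fcoef f j * fcoef g (k - j).
Proof. by []. Qed.
Lemma fcoef1 k : fcoef (1 : {fps R}) k = (k == 0%N)%:R.
Proof. by case: k. Qed.
Lemma fcoefB f g k : fcoef (f - g) k = fcoef f k - fcoef g k.
Proof. by []. Qed.

Fact fps_of_poly_zmod : zmod_morphism fps_of_poly.
Proof. by move=> p q; apply: fpsP => k /=; rewrite coefB. Qed.
Fact fps_of_poly_monoid : monoid_morphism fps_of_poly.
Proof.
split; first by apply: fpsP => k; rewrite fcoef1 /= coef1.
by move=> p q; apply: fpsP => k; rewrite fcoefM /= coefM.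
Qed.
HB.instance Definition _ :=
  GRing.isZmodMorphism.Build {poly R} {fps R} fps_of_poly fps_of_poly_zmod.
HB.instance Definition _ :=
  GRing.isMonoidMorphism.Build {poly R} {fps R} fps_of_poly fps_of_poly_monoid.

Lemma fps_of_poly_inj : injective fps_of_poly.
Proof.
by move=> p q /(congr1 (@fcoef R)) /= e; apply/polyP => k; exact: (congr1 (@^~ k) e).
Qed.

Lemma fpsX_geom (a : R) : (1 - fpsX * fpsC a) * Fps (fun k => a ^+ k) = 1.
Proof.
have XC k : fcoef (fpsX * fpsC a) k = (k == 1%N)%:R * a.
  rewrite fcoefM; case: k => [|k].
    by rewrite big_ord1 /= !mul0r.
  rewrite big_ord_recr /= subnn big1 ?add0r // => i _.
  by rewrite subSn ?mulr0 // -ltnS.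
have C k : fcoef (1 - fpsX * fpsC a) k = (k == 0%N)%:R - (k == 1%N)%:R * a.
  by rewrite fcoefB XC fcoef1.
apply: fpsP => k; rewrite fcoef1 fcoefM.
under eq_bigr => i _ do rewrite C.
rewrite big_ord_recl /= subn0 mul0r subr0 mul1r.
case: k => [|k]; first by rewrite big_ord0 addr0.
rewrite big_ord_recl /= sub0r mul1r subSS subn0 big1 ?addr0.
  by rewrite mulNr -exprS subrr.
by move=> i _; rewrite mul0r subr0 mul0r.
Qed.

Lemma fps_unit_geom (a : R) : 1 - fpsX * fpsC a \is a GRing.unit.
Proof. by apply/unitrP; exists (Fps (fun k => a ^+ k)); rewrite mulrC fpsX_geom. Qed.

End FpsRing.
Arguments fpsX {R}.

Definition map_fps (R S : Type) (u : R -> S) (f : {fps R}) : {fps S} :=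
  Fps (fun k => u (fcoef f k)).

Section FpsIdomain.
Variable R : idomainType.

Fact fps_mulf_eq0 (f g : {fps R}) : f * g = 0 -> (f == 0) || (g == 0).
Proof.
move=> fg0; have nz (h : {fps R}) : h != 0 -> exists k, fcoef h k != 0.
  move=> /eqP h0; apply: contrapT => nex; apply: h0; apply: fpsP => k /=.
  by apply/eqP/negPn/negP => hk; apply: nex; exists k.
have [//|/nz exf] := eqVneq f 0; have [//|/nz exg] := eqVneq g 0.
case: (ex_minnP exf) => i fi mini; case: (ex_minnP exg) => j gj minj.
have := congr1 (fun h => fcoef h (i + j)) fg0; rewrite fcoefM /=.
rewrite (bigD1 (inord i)) //= inordK ?ltnS ?leq_addr // addKn big1 ?addr0.
  by move=> /eqP; rewrite mulf_eq0 (negbTE fi) (negbTE gj).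
move=> k /eqP ki; have {}ki : k != i :> nat.
  by apply/eqP => ki'; apply: ki; apply: val_inj; rewrite /= inordK // ltnS leq_addr.
have [lt_ki|] := ltnP k i.
  have [->|/mini] := eqVneq (fcoef f k) 0; first by rewrite mul0r.
  by rewrite ltn_geF.
rewrite leq_eqVlt eq_sym (negbTE ki) /= => lt_ik.
have [->|/minj] := eqVneq (fcoef g (i + j - k)) 0; first by rewrite mulr0.
rewrite leq_subRL; last by rewrite -ltnS.
by rewrite leq_add2r ltn_geF.
Qed.

HB.instance Definition _ :=
  GRing.ComUnitRing_isIntegral.Build {fps R} fps_mulf_eq0.
End FpsIdomain.


Section LaurentExpansion.
Variable R : idomainType.
Implicit Types (p q : {poly R}) (x y : {fraction {poly R}}).
Local Notation "p %:F" := (@FracField.tofrac _ p).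

(* Expansion at the origin, from R(t) to the fraction field of R[[t]], which is
   the field of formal Laurent series when R is a field. *)
Definition laurent x : {fraction {fps R}} :=
  (fps_of_poly \n_(repr x))%:F / (fps_of_poly \d_(repr x))%:F.

Lemma frac_repr (D : idomainType) (x : {fraction D}) :
  x = (\n_(repr x))%:F / (\d_(repr x))%:F.
Proof.
apply: (canRL (mulfK _)); first by rewrite tofrac_eq0 denom_ratioP.
rewrite -[x in LHS]reprK; unlock FracField.tofrac.
rewrite -[LHS]FracField.pi_mul; apply/eqmodP.
rewrite /= FracField.equivfE /FracField.mulf.
rewrite !numden_Ratio ?oner_eq0 ?mulr1 ?mul1r ?denom_ratioP //.
by rewrite reprK mulrC.
Qed.

Lemma laurentE p q : q != 0 ->
  laurent (p%:F / q%:F) = (fps_of_poly p)%:F / (fps_of_poly q)%:F.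
Proof.
have F0 (r : {poly R}) : r != 0 -> (fps_of_poly r)%:F != 0.
  rewrite tofrac_eq0; apply: contra_neq => r0.
  by apply: fps_of_poly_inj; rewrite r0 rmorph0.
move=> q0; rewrite /laurent; set x := p%:F / q%:F.
have d0 : \d_(repr x) != 0 := denom_ratioP _.
apply/eqP; rewrite eqr_div ?F0 // -!rmorphM tofrac_eq.
have /eqP := frac_repr x; rewrite {1}/x eqr_div ?tofrac_eq0 //.
by rewrite -!rmorphM tofrac_eq => /eqP <-; rewrite mulrC.
Qed.

Fact laurent_zmod : zmod_morphism laurent.
Proof.
move=> x y; rewrite (frac_repr x) (frac_repr y).
set a := \n_(repr x); set b := \d_(repr x).
set c := \n_(repr y); set d := \d_(repr y).
have b0 : b != 0 := denom_ratioP _; have d0 : d != 0 := denom_ratioP _.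
have F0 (r : {poly R}) : r != 0 -> (fps_of_poly r)%:F != 0.
  rewrite tofrac_eq0; apply: contra_neq => r0.
  by apply: fps_of_poly_inj; rewrite r0 rmorph0.
rewrite -mulNr -rmorphN addf_div ?tofrac_eq0 // -!rmorphM -rmorphD.
rewrite !laurentE ?mulf_neq0 // -mulNr -rmorphN addf_div ?F0 //.
by rewrite !(rmorphN, rmorphM, rmorphD).
Qed.

Fact laurent_monoid : monoid_morphism laurent.
Proof.
split=> [|x y].
  have := laurentE 1 (oner_neq0 _).
  by rewrite !rmorph1 !divr1.
rewrite (frac_repr x) (frac_repr y).
have b0 : \d_(repr x) != 0 := denom_ratioP _.
have d0 : \d_(repr y) != 0 := denom_ratioP _.
by rewrite mulf_div -!rmorphM !laurentE ?mulf_neq0 // mulf_div -!rmorphM.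
Qed.

HB.instance Definition _ := GRing.isZmodMorphism.Build
  {fraction {poly R}} {fraction {fps R}} laurent laurent_zmod.
HB.instance Definition _ := GRing.isMonoidMorphism.Build
  {fraction {poly R}} {fraction {fps R}} laurent laurent_monoid.

End LaurentExpansion.

Reserved Notation "{ 'galg' K [ G ] }"
  (at level 0, K, G at level 2, format "{ 'galg'  K [ G ] }").

(* [{malg K[G]}] carries a ring structure only for monoids without nontrivial
   units, which excludes groups; only its Z-module structure is reused. *)
Definition galg (K : comNzRingType) (G : zmodType) := {malg K[G]}.
Notation "{ 'galg' K [ G ] }" := (galg K G) : type_scope.

HB.instance Definition _ (K : comNzRingType) (G : zmodType) :=
  GRing.Zmodule.on {galg K[G]}.

Section GroupAlgebra.
Variables (K : comNzRingType) (G : zmodType).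
Implicit Types (g h : {galg K[G]}) (k : G).

Definition gexp k : {galg K[G]} := << 1 *g k >>.

Definition galg_mul g h : {galg K[G]} :=
  \sum_(k <- msupp g) \sum_(l <- msupp h) << g@_k * h@_l *g k + l >>.

Local Notation one := (<< 1 *g 0 >> : {galg K[G]}).

Let mulw (d e : {fset G}) g h : (msupp g `<=` d)%fset -> (msupp h `<=` e)%fset ->
  galg_mul g h = \sum_(k <- d) \sum_(l <- e) << g@_k * h@_l *g k + l >>.
Proof.
move=> gd he; rewrite /galg_mul (big_fset_incl _ gd) /=.
  apply: eq_bigr => k _; apply: big_fset_incl => // l _ /mcoeff_outdom ->.
  by rewrite mulr0 monalgU0.
move=> k _ /mcoeff_outdom gk.
by rewrite big1 // => l _; rewrite gk mul0r monalgU0.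
Qed.

Fact galg_mulC : commutative galg_mul.
Proof.
move=> g h; rewrite /galg_mul exchange_big; apply: eq_bigr => k _.
by apply: eq_bigr => l _; rewrite mulrC addrC.
Qed.

Let mulDl : left_distributive galg_mul +%R.
Proof.
move=> g1 g2 g.
have := mulw (fsubsetUl (msupp g1) (msupp g2)) (fsubset_refl (msupp g)) => ->.
have := mulw (fsubsetUr (msupp g1) (msupp g2)) (fsubset_refl (msupp g)) => ->.
rewrite (mulw (msuppD_le g1 g2) (fsubset_refl _)) -big_split /=.
apply: eq_bigr => k _; rewrite -big_split /=; apply: eq_bigr => l _.
by rewrite mcoeffD mulrDl monalgUD.
Qed.

Let mulDr : right_distributive galg_mul +%R.
Proof. by move=> f g h; rewrite !(galg_mulC f) mulDl. Qed.
Let mul0g : left_zero 0 galg_mul.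
Proof. by move=> g; rewrite /galg_mul msupp0 big_seq_fset0. Qed.
Let mulg0 : right_zero 0 galg_mul.
Proof. by move=> g; rewrite galg_mulC mul0g. Qed.

Let mulUU (a b : K) k l : galg_mul << a *g k >> << b *g l >> = << a * b *g k + l >>.
Proof. by rewrite (mulw msuppU_le msuppU_le) !big_seq_fset1 !mcoeffUU. Qed.

Let sum_l g (s : seq G) F :
  galg_mul (\sum_(k <- s) F k) g = \sum_(k <- s) galg_mul (F k) g.
Proof. exact: (big_morph (galg_mul^~ g) (fun _ _ => mulDl _ _ _) (mul0g _)). Qed.
Let sum_r g (s : seq G) F :
  galg_mul g (\sum_(k <- s) F k) = \sum_(k <- s) galg_mul g (F k).
Proof. exact: (big_morph (galg_mul g) (fun _ _ => mulDr _ _ _) (mulg0 _)). Qed.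

Fact galg_mulA : associative galg_mul.
Proof.
move=> f g h; rewrite (monalgE f) (monalgE g) (monalgE h).
rewrite [LHS]sum_l [X in _ = galg_mul X _]sum_l [RHS]sum_l.
apply: eq_bigr => k _.
rewrite [X in galg_mul _ X = _]sum_l [LHS]sum_r.
rewrite [X in _ = galg_mul X _]sum_r [RHS]sum_l; apply: eq_bigr => l _.
rewrite [X in galg_mul _ X = _]sum_r [LHS]sum_r [RHS]sum_r.
apply: eq_bigr => m _.
by rewrite !mulUU mulrA addrA.
Qed.

Fact galg_mul1 : left_id one galg_mul.
Proof.
move=> g; rewrite {1}(monalgE g) sum_r [RHS]monalgE; apply: eq_bigr => k _.
by rewrite mulUU mul1r add0r.
Qed.

Fact galg_1neq0 : one != 0.
Proof. by rewrite monalgU_eq0 oner_eq0. Qed.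

HB.instance Definition _ := GRing.Zmodule_isComNzRing.Build {galg K[G]}
  galg_mulA galg_mulC galg_mul1 mulDl galg_1neq0.

Lemma gexp0 : gexp 0 = 1. Proof. by []. Qed.
Lemma gexpD k l : gexp (k + l) = gexp k * gexp l.
Proof. by rewrite [RHS]mulUU mulr1. Qed.

Definition gbar g : {galg K[G]} := \sum_(k <- msupp g) << g@_k *g - k >>.

Lemma gbarE g k : (gbar g)@_k = g@_(- k).
Proof.
rewrite /gbar raddf_sum /=; have [kg|kg] := boolP (- k \in msupp g).
  rewrite (big_fsetD1 (- k)) //= mcoeffU opprK eqxx big1_fset ?addr0 // => l.
  by rewrite in_fsetD1 mcoeffU eqr_oppLR; case: eqP.
rewrite big1_fset ?mcoeff_outdom // => l lg _.
by rewrite mcoeffU eqr_oppLR; case: eqP lg kg => // ->  ->.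
Qed.

End GroupAlgebra.
Arguments gexp {K G} k.

Definition root_lattice_pred (n : nat) : {pred 'rV[int]_n.+1} :=
  fun v => \sum_i v 0 i == 0.
Arguments root_lattice_pred : simpl never.
Definition root_lattice (n : nat) := [qualify a v | root_lattice_pred (n := n) v].

Fact root_lattice_zmod n : zmod_closed (@root_lattice_pred n).
Proof.
split=> [|u v /eqP u0 /eqP v0]; apply/eqP.
  by rewrite big1 // => i _; rewrite mxE.
under eq_bigr => i _ do rewrite !mxE.
by rewrite sumrB u0 v0 subr0.
Qed.
HB.instance Definition _ n :=
  GRing.isZmodClosed.Build _ (@root_lattice_pred n) (@root_lattice_zmod n).

Record weight (n : nat) := Weight {
  wval :> 'rV[int]_n.+1;
  _ : wval \is a root_lattice n }.
HB.instance Definition _ n := [isSub for @wval n].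
HB.instance Definition _ n := [Choice of weight n by <:].
#[warning="-redundant-canonical-projection"]
HB.instance Definition _ n := [SubChoice_isSubZmodule of weight n by <:].

Section TypeA.
Variable n : nat.
Implicit Types (lam mu : weight n) (i j : 'I_n.+1) (p : 'I_n.+1 * 'I_n.+1).

Definition coord lam i : int := wval lam 0 i.

Fact root_subproof i j :
  (delta_mx 0 i - delta_mx 0 j : 'rV[int]_n.+1) \is a root_lattice n.
Proof.
have S k : \sum_l (delta_mx 0 k : 'rV[int]_n.+1) 0 l = 1.
  by rewrite (bigD1 k) //= mxE !eqxx big1 ?addr0 // => l /negbTE lk; rewrite mxE lk.
apply/eqP; transitivity (\sum_l (delta_mx 0 i : 'rV[int]_n.+1) 0 l -
    \sum_l (delta_mx 0 j : 'rV[int]_n.+1) 0 l); last by rewrite !S subrr.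
by rewrite -sumrB; apply: eq_bigr => l _; rewrite !mxE.
Qed.

(* eps_i - eps_j; it is a positive root when i < j. *)
Definition root p : weight n := Weight (root_subproof p.1 p.2).

Definition rho : 'rV[rat]_n.+1 :=
  2^-1 *: \sum_(p : 'I_n.+1 * 'I_n.+1 | (p.1 < p.2)%N) map_mx intr (root p).

Definition ht lam : rat := \sum_i (coord lam i)%:~R * rho 0 i.

Lemma ht_def lam : ht lam =
  2^-1 * \sum_(p : 'I_n.+1 * 'I_n.+1 | (p.1 < p.2)%N)
    (coord lam p.1 - coord lam p.2)%:~R.
Proof.
rewrite /ht; under eq_bigr => i _ do
  rewrite mxE summxE mulrCA; rewrite -mulr_sumr; congr (_ * _).
under eq_bigr => i _ do rewrite mulr_sumr.
rewrite exchange_big /=; apply: eq_bigr => p lt_p.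
have p12 : p.1 != p.2 by apply: contraTneq lt_p => ->; rewrite ltnn.
rewrite (bigD1 p.1) //= (bigD1 p.2) 1?eq_sym //= big1 ?addr0.
  rewrite !mxE !eqxx (negbTE p12) eq_sym (negbTE p12) /= subr0 sub0r.
  by rewrite mulr1 rmorphN1 mulrN1 rmorphB.
by move=> i /andP[/negbTE i1 /negbTE i2]; rewrite !mxE i1 i2 andbF subrr mulr0.
Qed.

Lemma ht_floor lam : (Num.floor (ht lam))%:~R = ht lam.
Proof.
suff -> : ht lam = (- \sum_(p : 'I_n.+1 * 'I_n.+1 | (p.1 < p.2)%N) coord lam p.2)%:~R.
  by rewrite intrKfloor.
have sum0 : \sum_(p : 'I_n.+1 * 'I_n.+1 | p.1 != p.2) coord lam p.1 = 0.
  transitivity (\sum_i \sum_(j | i != j) coord lam i); first by rewrite pair_big_dep.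
  transitivity (\sum_i coord lam i *+ n).
    apply: eq_bigr => i _; rewrite sumr_const; congr (_ *+ _).
    rewrite (eq_card (B := predC1 i)) ?cardC1 ?card_ord //.
    by move=> j; rewrite !inE eq_sym.
  by rewrite sumrMnl (eqP (valP lam)) mul0rn.
rewrite (bigID (fun p : 'I_n.+1 * 'I_n.+1 => (p.1 < p.2)%N)) /= in sum0.
rewrite [X in _ + X](reindex_inj (can_inj (@swap_pairK _ _))) /= in sum0.
rewrite (eq_bigl (fun p : 'I_n.+1 * 'I_n.+1 => (p.1 < p.2)%N)) in sum0; last first.
  by move=> p /=; rewrite -val_eqE /= neq_ltn; case: ltngtP.
rewrite [X in _ + X](eq_bigl (fun p : 'I_n.+1 * 'I_n.+1 => (p.1 < p.2)%N)) in sum0; last first.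
  by move=> p /=; rewrite -val_eqE /= neq_ltn; case: ltngtP.
rewrite ht_def -rmorph_sum sumrB -(addr0_eq sum0) !opprK -mulr2n rmorphMn.
by rewrite -[X in 2^-1 * X]mulr_natl mulKf.
Qed.

(* A weight is first layer when its smallest coordinate is -1, or it is 0. *)
Definition first_layer lam : bool :=
  (lam == 0) ||
  [forall i, -1 <= coord lam i] && [exists i, coord lam i == -1].

Definition colength lam : nat := #|[pred i | coord lam i < 0]|.

Fact srefl_subproof (i : 'I_n) lam :
  col_perm (tperm (inord i) (inord i.+1)) lam \is a root_lattice n.
Proof.
apply/eqP; rewrite -[RHS](eqP (valP lam)).
rewrite [RHS](reindex_inj (@perm_inj _ (tperm (inord i) (inord i.+1)))) /=.
by apply: eq_bigr => j _; rewrite mxE.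
Qed.
Definition srefl (i : 'I_n) lam : weight n := Weight (srefl_subproof i lam).

Definition local_refl (i : 'I_n) lam : weight n :=
  if (0 <= coord lam (inord i)) && (0 <= coord lam (inord i.+1)) then lam
  else srefl i lam.

(* The s_i generate S_(n+1), so the orbits of its local action are obtained by
   applying all words in the generators. *)
Definition local_orbit lam : set (weight n) :=
  [set mu | exists w : seq 'I_n, mu = foldr local_refl lam w].

Definition quasi_dominant lam : Prop :=
  first_layer lam /\ forall mu, local_orbit lam mu -> ht mu <= ht lam.

(* p encodes a positive root whose subtraction from lam lowers the co-length
   by one; co-length only makes sense for first layer weights. *)
Definition removable lam p : bool :=
  [&& (p.1 < p.2)%N, first_layer (lam - root p)
    & (colength (lam - root p)).+1 == colength lam].

(* The default (ord0, ord_max) is irrelevant: for quasi-dominant lam != 0 some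
   root is removable and the one of smallest height is unique. *)
Definition last_root lam : weight n :=
  root (odflt (ord0, ord_max) [pick p | removable lam p &&
    [forall q, removable lam q ==> (ht (root p) <= ht (root q))]]).

Fixpoint canonical_expr_rec (N : nat) lam : seq (weight n) :=
  if N is N'.+1 then
    rcons (canonical_expr_rec N' (lam - last_root lam)) (last_root lam)
  else [::].
Definition canonical_expr lam := canonical_expr_rec (colength lam) lam.

Definition height_set lam : seq rat := [seq ht beta | beta <- canonical_expr lam].

Definition qsub mu lam : Prop := {subset height_set mu <= height_set lam}.

Local Open Scope classical_set_scope.

Lemma first_layer_bounds lam : first_layer lam ->
  forall i, - 1 <= coord lam i <= n%:Z.
Proof.
rewrite /first_layer; have [-> _ i|_ /=] := eqVneq lam 0; first by rewrite /coord mxE.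
case/andP => /forallP ge1 _ i; rewrite ge1 /=.
have := eqP (valP lam); rewrite (bigD1 i) //= => /eqP.
rewrite addr_eq0 => /eqP e; rewrite /coord e -sumrN.
have -> : n%:Z = \sum_(j | j != i) 1.
  by rewrite sumr_const cardC1 card_ord natz.
by apply: ler_sum => j _; rewrite lerNl; exact: ge1.
Qed.

Lemma finite_first_layer : finite_set [set lam | first_layer lam].
Proof.
pose dec (f : {ffun 'I_n.+1 -> 'I_n.+2}) : weight n :=
  insubd 0 (\row_i ((f i)%:Z - 1)).
apply: (@sub_finite_set _ _ (range dec)); last exact: finite_image finite_finset.
move=> lam /= /first_layer_bounds bnd.
exists [ffun i => inord (absz (coord lam i + 1))] => //.
rewrite /dec; set v := \row_i _; suff -> : v = val lam by rewrite valKd.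
apply/rowP => i; rewrite mxE ffunE; have /andP[ge1 len] := bnd i.
by rewrite inordK; move: ge1 len; rewrite /coord /=; set x := wval lam 0 i; lia.
Qed.

Lemma local_refl_first_layer (i : 'I_n) lam :
  first_layer lam -> first_layer (local_refl i lam).
Proof.
rewrite /local_refl; case: ifP => // _.
have C (l : weight n) j :
    coord (srefl i l) j = coord l (tperm (inord i) (inord i.+1) j).
  by rewrite /coord mxE.
case/orP => [/eqP ->|/andP[/forallP ge1 /existsP[j /eqP ej]]].
  apply/orP; left; apply/eqP/val_inj/rowP => j.
  by have := C 0 j; rewrite /coord !mxE.
apply/orP; right; apply/andP; split; first by apply/forallP => k; rewrite C.
by apply/existsP; exists (tperm (inord i) (inord i.+1) j); rewrite C tpermK ej.
Qed.

Lemma finite_quasi_dominant : finite_set [set lam | quasi_dominant lam].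
Proof. by apply: sub_finite_set finite_first_layer => lam []. Qed.

Lemma finite_local_orbit lam : first_layer lam -> finite_set (local_orbit lam).
Proof.
move=> fl; apply: sub_finite_set finite_first_layer => _ [w ->] /=.
by elim: w => //= i w IH; exact: local_refl_first_layer.
Qed.

Variable K : comNzRingType.

(* Both sums below range over finite sets, by [finite_local_orbit] and
   [finite_quasi_dominant]. *)
Definition qmonomial lam : {galg K[weight n]} :=
  \sum_(mu \in local_orbit lam) (gexp mu : {galg K[weight n]}).

Definition qfundamental lam : {galg K[weight n]} :=
  \sum_(mu \in [set mu | quasi_dominant mu /\ qsub mu lam]) qmonomial mu.

End TypeA.

(* The volume one Haar integral on the torus with character lattice
   [weight n]: it is linear and sends e^lam to 1 if lam = 0 and to 0 otherwise. *)
Definition torus_int (K : comNzRingType) (n : nat) (f : {galg K[weight n]}) : K :=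
  f@_0.

(* C(t), expanded in powers of t; its denominators are invertible by [fps_unit_geom]. *)
Definition cherednik_kernel (n : nat) : {fps {galg rat[weight n]}} :=
  \prod_(p : 'I_n.+1 * 'I_n.+1 | (p.1 < p.2)%N)
    ((1 - fpsC (gexp (root p))) / (1 - fpsX * fpsC (gexp (root p)))).

(* The integral of f * gbar g * C(t): the integral of e^k * C(t) is taken
   coefficientwise in t, and extended linearly over Q(t), inside Q((t)). *)
Definition scalar_product (n : nat)
    (f g : {galg {fraction {poly rat}}[weight n]}) : {fraction {fps rat}} :=
  let h := f * gbar g in
  \sum_(k <- msupp h) laurent (h@_k) *
    FracField.tofrac (map_fps (@torus_int rat n)
      (fpsC (gexp k) * cherednik_kernel n)).

Definition tvar : {fraction {poly rat}} := FracField.tofrac 'X.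

(* Main.v *)
(* Write c(mu) for the coefficient of e^mu in C(t).  The ratio of C(t) and its
   image under s_i gives, for adjacent coordinates,
     c(.. x, y ..) + c(.. y+1, x-1 ..) = t (c(.. y, x ..) + c(.. x-1, y+1 ..)),
   and c(mu) = 0 as soon as some final sum of coordinates of mu is positive.
   By induction on j these yield
     c(u, x+1, (-1)^(j+1), 0^r) = (t^(j+1) - 1) c(u, x, (-1)^j, 0^(r+1)).
   A local orbit consists of all shuffles of a nonnegative sequence with a
   sequence of -1's; summing c over it, the Gaussian binomials coming from
   shuffling the final zeros with -1's turn t^(j+1) - 1 into t^(r+1) - 1, where
   r+1 is the height of the last root of the canonical expression.  Hence
   <1, M_mu> is the product of t^h - 1 over h in Ht(mu).  As Ht is a bijection
   from quasi-dominant weights to subsets of {1, .., n}, summing over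
   mu <= lam gives the product of t^h over h in Ht(lam), that is t^ht(lam). *)

Require Import Defs.
From HB Require Import structures.
From mathcomp Require Import all_boot all_order all_algebra.
From mathcomp Require Import perm finmap monalg zify ring lra.
From mathcomp Require Import classical_sets fsbigop.

Set Implicit Arguments.
Unset Strict Implicit.
Unset Printing Implicit Defensive.

Import Order.TTheory GRing.Theory Num.Theory.

Local Open Scope ring_scope.

(* [all_algebra] shadows these with polynomial roots and vector coordinates. *)
Local Notation root := Defs.root.
Local Notation coord := Defs.coord.

(** * Sums of an abstract coefficient function over shuffles with -1's *)

Section ShuffleSums.
Variables (A : comNzRingType) (t : A) (f : seq int -> A).

(** Branching on the first letter shortens either [a] or the run of -1's; hence the nested
    fixpoint. *)
Fixpoint shuffle (a : seq nat) (N : nat) : seq (seq int) :=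
  if a is x :: a' then
    (fix insert_neg (N : nat) : seq (seq int) :=
      if N is N'.+1 then
        map (cons x%:Z) (shuffle a' N) ++ map (cons (-1)) (insert_neg N')
      else [:: map Posz a]) N
  else [:: nseq N (-1)].

Lemma shuffle0 a : shuffle a 0 = [:: map Posz a].
Proof. by case: a. Qed.

(** The prefix [u] collects the letters already read, so that splitting on the first letter stays
    within sums of this form. *)
Definition shuffle_sum u a N := \sum_(w <- shuffle a N) f (u ++ w).

Lemma shuffle_sum0 u a : shuffle_sum u a 0 = f (u ++ map Posz a).
Proof. by rewrite /shuffle_sum shuffle0 big_seq1. Qed.

Lemma shuffle_sum_nil u N : shuffle_sum u [::] N = f (u ++ nseq N (-1)).
Proof. by rewrite /shuffle_sum big_seq1. Qed.

Lemma shuffle_sumS u x a N : shuffle_sum u (x :: a) N.+1 =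
  shuffle_sum (rcons u x%:Z) a N.+1 + shuffle_sum (rcons u (-1)) (x :: a) N.
Proof.
rewrite /shuffle_sum [shuffle (x :: a) N.+1]/= big_cat !big_map.
by congr (_ + _); apply: eq_bigr => w _; rewrite cat_rcons.
Qed.

(** What is retained of the coefficients of C(t): the exchange identity when one of the adjacent
    coordinates is -1, and the vanishing for a positive final sum. *)
Hypothesis f_swap0 : forall u v, f (u ++ 0 :: -1 :: v) = t * f (u ++ -1 :: 0 :: v).
Hypothesis f_swapS : forall u v (x : nat),
  f (u ++ x.+1%:Z :: -1 :: v) + f (u ++ 0 :: x%:Z :: v) =
  t * (f (u ++ -1 :: x.+1%:Z :: v) + f (u ++ x%:Z :: 0 :: v)).
Hypothesis f_final_gt0 : forall u v, 0 < \sum_(x <- v) x -> f (u ++ v) = 0.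

Local Notation negs j := (nseq j (-1 : int)).
Local Notation zeros r := (nseq r (0 : int)).

Lemma zero_past_negs u j v :
  f (u ++ 0 :: negs j ++ v) = t ^+ j * f (u ++ negs j ++ 0 :: v).
Proof.
elim: j u => [|j IH] u; first by rewrite expr0 mul1r.
rewrite /= f_swap0 -[u ++ -1 :: 0 :: _]cat_rcons IH exprS mulrA cat_rcons.
by [].
Qed.

Lemma final_pos_zeros u x r : f (u ++ x.+1%:Z :: zeros r) = 0.
Proof.
apply: f_final_gt0; rewrite big_cons big1_seq ?addr0 // => y /andP[_].
by rewrite mem_nseq => /andP[_ /eqP].
Qed.

(** Induction on [j]. Exchanging [x.+1] with the first -1 produces three words; the -1's left in
    each are handled by the induction hypothesis or by [zero_past_negs]. *)
Lemma lower_step u x j r :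
  f (u ++ x.+1%:Z :: negs j.+1 ++ zeros r) =
  (t ^+ j.+1 - 1) * f (u ++ x%:Z :: negs j ++ zeros r.+1).
Proof.
have swapS x' u' v' : f (u' ++ x'.+1%:Z :: -1 :: v') =
    t * f (u' ++ -1 :: x'.+1%:Z :: v') + t * f (u' ++ x'%:Z :: 0 :: v')
    - f (u' ++ 0 :: x'%:Z :: v').
  by rewrite -mulrDr -f_swapS addrK.
elim: j u x r => [|j IH] u x r.
  (* With a single -1, moving it to the left leaves a positive entry followed by zeros only, so that
     term vanishes; for positive [x] the other two vanish likewise. *)
  rewrite expr1 /= swapS -[u ++ -1 :: _]cat_rcons final_pos_zeros mulr0 add0r.
  case: x => [|x]; first by rewrite mulrBl mul1r.
  rewrite -[u ++ 0 :: _]cat_rcons final_pos_zeros subr0.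
  by rewrite (final_pos_zeros u x r.+1) !mulr0.
have low y : f (u ++ y%:Z :: 0 :: negs j.+1 ++ zeros r) =
    t ^+ j.+1 * f (u ++ y%:Z :: negs j.+1 ++ zeros r.+1).
  by rewrite -cat_rcons zero_past_negs cat_rcons.
have lower y : f (u ++ y :: x.+1%:Z :: negs j.+1 ++ zeros r) =
    (t ^+ j.+1 - 1) * f (u ++ y :: x%:Z :: negs j ++ zeros r.+1).
  by rewrite -cat_rcons IH cat_rcons.
have -> : f (u ++ x.+1%:Z :: negs j.+2 ++ zeros r) =
    f (u ++ x.+1%:Z :: -1 :: negs j.+1 ++ zeros r) by [].
rewrite swapS lower low; case: x lower => [|x] lower.
  have -> : f (u ++ 0 :: 0%:Z :: negs j.+1 ++ zeros r) =
    t ^+ j.+1 * f (u ++ 0%:Z :: negs j.+1 ++ zeros r.+1) by apply: low.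
  have -> : f (u ++ -1 :: 0%:Z :: negs j ++ zeros r.+1) =
      t ^+ j * f (u ++ -1 :: negs j ++ zeros r.+2).
    by rewrite -cat_rcons zero_past_negs cat_rcons.
  have -> : f (u ++ 0%:Z :: negs j.+1 ++ zeros r.+1) =
      t ^+ j.+1 * f (u ++ negs j.+1 ++ zeros r.+2) by apply: zero_past_negs.
  rewrite -[negs j.+1 ++ zeros r.+2]/(-1 :: negs j ++ zeros r.+2) !exprS; ring.
have -> : f (u ++ 0 :: x.+1%:Z :: negs j.+1 ++ zeros r) =
    (t ^+ j.+1 - 1) * f (u ++ 0 :: x%:Z :: negs j ++ zeros r.+1).
  by rewrite -cat_rcons IH cat_rcons.
(* Two expressions for the same value [Y]: the induction hypothesis and the exchange identity.
   Eliminating [W] and [Z] leaves a polynomial identity in [Y] and [V]. *)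
have E1 := IH u x r.+1.
have E2 := swapS x u (negs j ++ zeros r.+1).
have E3 : f (u ++ x%:Z :: 0 :: negs j ++ zeros r.+1) =
    t ^+ j * f (u ++ x%:Z :: negs j ++ zeros r.+2).
  by rewrite -cat_rcons zero_past_negs cat_rcons.
rewrite E3 -[f _]/(f (u ++ x.+1%:Z :: negs j.+1 ++ zeros r.+1)) in E2.
move: E1 E2.
move: (f (u ++ x.+1%:Z :: negs j.+1 ++ zeros r.+1)) => Y.
move: (f (u ++ x%:Z :: negs j ++ zeros r.+2)) => Z.
move: (f (u ++ -1 :: _)) => V.
move: (f (u ++ 0 :: x%:Z :: _)) => W E1 E2.
have -> : W = t * V + t * (t ^+ j * Z) - Y by rewrite E2; ring.
rewrite !exprS in E1 *.
have -> : (t * t ^+ j - 1) * (t * V + t * (t ^+ j * Z) - Y) =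
    (t * t ^+ j - 1) * t * V + t * t ^+ j * ((t * t ^+ j - 1) * Z)
    - (t * t ^+ j - 1) * Y by ring.
rewrite -E1; ring.
Qed.

(* The Gaussian binomial coefficient [r + N choose N]. *)
Fixpoint qbinom (r : nat) : nat -> A :=
  if r is r'.+1 then
    fix qbinomr (N : nat) : A :=
      if N is N'.+1 then t ^+ N * qbinom r' N + qbinomr N' else 1
  else fun=> 1.

Lemma qbinomr0 r : qbinom r 0 = 1. Proof. by case: r. Qed.
Lemma qbinom0N N : qbinom 0 N = 1. Proof. by []. Qed.
Lemma qbinomSS r N : qbinom r.+1 N.+1 = t ^+ N.+1 * qbinom r N.+1 + qbinom r.+1 N.
Proof. by []. Qed.

Lemma qbinom_shift r N :
  (t ^+ r.+1 - 1) * qbinom r.+1 N = (t ^+ N.+1 - 1) * qbinom r N.+1.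
Proof.
elim: r N => [|r IHr] N.
  elim: N => [|N IHN]; first by rewrite !expr1.
  rewrite qbinomSS qbinom0N mulr1 mulrDr IHN !qbinom0N !exprS; ring.
elim: N => [|N IHN].
  have := IHr 0%N; rewrite !qbinomr0 => E.
  have -> : (t ^+ 1 - 1) * (t ^+ 1 * qbinom r 1 + 1) =
      t * ((t ^+ 1 - 1) * qbinom r 1) + (t - 1) by ring.
  by rewrite -E !exprS; ring.
rewrite qbinomSS mulrDr IHN [qbinom r.+1 N.+2]qbinomSS.
have -> : (t ^+ N.+2 - 1) * (t ^+ N.+2 * qbinom r N.+2 + qbinom r.+1 N.+1) =
    t ^+ N.+2 * ((t ^+ N.+2 - 1) * qbinom r N.+2) + (t ^+ N.+2 - 1) * qbinom r.+1 N.+1.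
  by ring.
by rewrite -IHr !exprS; ring.
Qed.

(** Every word is compared with the one where all -1's come first. A leading zero has to pass [N.+1]
    letters -1, which gives the power of t in the Pascal rule. *)
Lemma shuffle_sum_zeros v r N :
  shuffle_sum v (nseq r 0%N) N = qbinom r N * f (v ++ negs N ++ zeros r).
Proof.
elim: r v N => [|r IHr] v N; first by rewrite shuffle_sum_nil mul1r cats0.
elim: N v => [|N IHN] v; first by rewrite shuffle_sum0 map_nseq qbinomr0 mul1r.
rewrite shuffle_sumS IHr IHN qbinomSS mulrDl !cat_rcons zero_past_negs.
by rewrite mulrCA mulrA.
Qed.

Lemma shuffle_sum_lower0 u b x r : shuffle_sum u (b ++ x.+1 :: nseq r 0%N) 0 = 0.
Proof. by rewrite shuffle_sum0 map_cat catA /= map_nseq final_pos_zeros. Qed.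

(** Both sides obey the same recursion on the first letter, until [x.+1] is read. Then only zeros
    and -1's remain, and [qbinom_shift] trades the factor of [lower_step], which depends on the
    number of -1's, for one that can be pulled out of the whole sum. *)
Lemma shuffle_sum_lower u b x r N :
  shuffle_sum u (b ++ x.+1 :: nseq r 0%N) N.+1 =
  (t ^+ r.+1 - 1) * shuffle_sum u (b ++ x :: nseq r.+1 0%N) N.
Proof.
have top v M : shuffle_sum (rcons v x.+1%:Z) (nseq r 0%N) M.+1 =
    (t ^+ r.+1 - 1) * shuffle_sum (rcons v x%:Z) (nseq r.+1 0%N) M.
  rewrite !shuffle_sum_zeros !cat_rcons lower_step [RHS]mulrA.
  by rewrite qbinom_shift mulrCA mulrA.
elim: b u N => [|y b IHb] u N.
  elim: N u => [|N IHN] u.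
    rewrite shuffle_sumS top (shuffle_sum_lower0 _ [::]) addr0 !shuffle_sum0.
    by rewrite cat_rcons.
  rewrite [LHS]shuffle_sumS top [X in _ + X]IHN -mulrDr; congr (_ * _).
  by rewrite [RHS]shuffle_sumS.
elim: N u => [|N IHN] u.
  rewrite shuffle_sumS IHb -[y :: b ++ x.+1 :: _]cat_cons (shuffle_sum_lower0 _ (y :: b)) addr0.
  by rewrite !shuffle_sum0 cat_rcons.
rewrite [LHS]shuffle_sumS IHb [X in _ + X]IHN -mulrDr; congr (_ * _).
by rewrite [RHS]shuffle_sumS.
Qed.

End ShuffleSums.

(** * Group algebras: products by coefficients and the action of an involution *)

Section GroupAlgebraTheory.
Variables (K : comNzRingType) (G : zmodType).
Implicit Types (g h : {galg K[G]}) (k l m : G).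

Lemma mcoeffM g h m : (g * h)@_m = \sum_(k <- msupp g) g@_k * h@_(m - k).
Proof.
rewrite [g * h]/(galg_mul g h) /galg_mul raddf_sum; apply: eq_bigr => k _.
rewrite raddf_sum /=; have [mh|mh] := boolP (m - k \in msupp h).
  rewrite (big_fsetD1 (m - k)) //= mcoeffU [k + _]addrC subrK eqxx.
  rewrite big1_fset ?addr0 // => l; rewrite in_fsetD1 => /andP[lmk _] _.
  by rewrite mcoeffU; case: eqP => // E; rewrite -E addrC addKr eqxx in lmk.
rewrite big1_fset ?(mcoeff_outdom mh) ?mulr0 // => l lh _.
by rewrite mcoeffU; case: eqP => // E; rewrite -E addrC addKr lh in mh.
Qed.

Lemma mcoeff_gexpM k g m : (gexp k * g)@_m = g@_(m - k).
Proof.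
rewrite mcoeffM /gexp msuppU oner_eq0 big_seq_fset1 mcoeffUU mul1r.
by [].
Qed.

Lemma gexpMn k j : gexp (k *+ j) = gexp k ^+ j :> {galg K[G]}.
Proof. by elim: j => [|j IH]; rewrite ?gexp0 // mulrS gexpD IH exprS. Qed.

Lemma monalgUM (a b : K) k l :
  (<< a *g k >> : {galg K[G]}) * << b *g l >> = << a * b *g k + l >>.
Proof.
apply/malgP => m; rewrite mcoeffM.
have [->|a0] := eqVneq a 0.
  by rewrite monalgU0 msupp0 big_seq_fset0 mul0r monalgU0 mcoeff0.
rewrite msuppU (negPf a0) big_seq_fset1 mcoeffUU !mcoeffU mulrnAr.
by rewrite eq_sym subr_eq eq_sym addrC.
Qed.

Variables (s : G -> G) (s_add : {morph s : k l / k + l}) (sK : involutive s).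

Definition gperm g : {galg K[G]} := \sum_(k <- msupp g) << g@_k *g s k >>.

Lemma gpermE g m : (gperm g)@_m = g@_(s m).
Proof.
rewrite /gperm raddf_sum /=; have [mg|mg] := boolP (s m \in msupp g).
  rewrite (big_fsetD1 (s m)) //= mcoeffU sK eqxx big1_fset ?addr0 // => l.
  rewrite in_fsetD1 => /andP[lm _] _; rewrite mcoeffU.
  by case: eqP => // E; rewrite -E sK eqxx in lm.
rewrite big1_fset ?mcoeff_outdom // => l lg _.
by rewrite mcoeffU; case: eqP => // E; rewrite -E sK lg in mg.
Qed.

Lemma gpermD : {morph gperm : g h / g + h}.
Proof. by move=> g h; apply/malgP => m; rewrite mcoeffD !gpermE mcoeffD. Qed.
Lemma gpermB : {morph gperm : g h / g - h}.
Proof. by move=> g h; apply/malgP => m; rewrite mcoeffB !gpermE mcoeffB. Qed.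
Lemma gperm0 : gperm 0 = 0.
Proof. by apply/malgP => m; rewrite gpermE !mcoeff0. Qed.
Lemma gpermU (a : K) k : gperm << a *g k >> = << a *g s k >>.
Proof. by apply/malgP => m; rewrite gpermE !mcoeffU -(inj_eq (inv_inj sK)) sK. Qed.
Lemma gperm_gexp k : gperm (gexp k) = gexp (s k). Proof. exact: gpermU. Qed.
Lemma gpermM : {morph gperm : g h / g * h}.
Proof.
move=> g h; rewrite [g * h]/(galg_mul g h) /galg_mul.
rewrite (big_morph _ gpermD gperm0) {2 3}/gperm mulr_suml; apply: eq_bigr => k _.
rewrite (big_morph _ gpermD gperm0) mulr_sumr; apply: eq_bigr => l _.
by rewrite gpermU monalgUM s_add.
Qed.

End GroupAlgebraTheory.

(** * Power series over a group algebra, and supports in a half-space *)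

Lemma map_fpsM (R S : comNzRingType) (u : R -> S) :
  {morph u : x y / x + y} -> {morph u : x y / x * y} -> u 0 = 0 ->
  {morph map_fps u : F H / F * H}.
Proof.
move=> uD uM u0 F H; apply: fpsP => k; rewrite fcoefM /= (big_morph u uD u0).
by apply: eq_bigr => j _; rewrite uM.
Qed.

Section FpsCoef.
Variable R : comNzRingType.
Implicit Types F H : {fps R}.

Lemma fcoefCM (c : R) F k : fcoef (fpsC c * F) k = c * fcoef F k.
Proof.
rewrite fcoefM big_ord_recl subn0 big1 ?addr0 // => j _.
by rewrite mul0r.
Qed.

Lemma fcoefXM F k : fcoef (fpsX * F) k = if k is k'.+1 then fcoef F k' else 0.
Proof.
rewrite fcoefM big_ord_recl /= mul0r add0r.
case: k => [|k]; first by rewrite big_ord0.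
rewrite big_ord_recl /= mul1r subSS subn0 big1 ?addr0 // => j _.
by rewrite mul0r.
Qed.

End FpsCoef.

Section FpsMcoeff.
Variables (K : comNzRingType) (G : zmodType).
Implicit Types (F H : {fps {galg K[G]}}) (k m : G).

Definition fps_mcoeff m F : {fps K} := map_fps (mcoeff m) F.

Lemma fcoef_mcoeff m F j : fcoef (fps_mcoeff m F) j = (fcoef F j)@_m.
Proof. by []. Qed.

Lemma fps_mcoeffB m : {morph fps_mcoeff m : F H / F - H}.
Proof. by move=> F H; apply: fpsP => k; rewrite fcoefB /= mcoeffB. Qed.

Lemma fps_mcoeffXM m F : fps_mcoeff m (fpsX * F) = fpsX * fps_mcoeff m F.
Proof.
apply: fpsP => k; rewrite fcoef_mcoeff !fcoefXM.
by case: k => [|k] //; rewrite mcoeff0.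
Qed.

Lemma fps_mcoeff_gexpM m k F :
  fps_mcoeff m (fpsC (gexp k) * F) = fps_mcoeff (m - k) F.
Proof. by apply: fpsP => j; rewrite !fcoef_mcoeff fcoefCM mcoeff_gexpM. Qed.

Lemma fps_mcoeff_reflection m k F H :
  fpsX * F - fpsC (gexp k) * F = H - fpsX * (fpsC (gexp k) * H) ->
  fpsX * fps_mcoeff m F - fps_mcoeff (m - k) F =
  fps_mcoeff m H - fpsX * fps_mcoeff (m - k) H.
Proof.
move=> E; rewrite -!fps_mcoeff_gexpM -!fps_mcoeffXM -!fps_mcoeffB.
by rewrite E.
Qed.

Variable psi : {additive G -> int}.
(** All exponents occurring in [F] lie in the open half-space psi > 0. Such series are closed under
    products, because psi m <= 0 forces one of two summands of m to have psi <= 0. *)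
Definition psi_pos F := forall j m, psi m <= 0 -> (fcoef F j)@_m = 0.

Lemma psi_posD F H : psi_pos F -> psi_pos H -> psi_pos (F + H).
Proof. by move=> pF pH j m m0; rewrite fcoefD mcoeffD pF ?pH ?addr0. Qed.

Lemma psi_posM F H : psi_pos F -> psi_pos H -> psi_pos (F * H).
Proof.
move=> pF pH j m m0; rewrite fcoefM raddf_sum big1 // => i _ /=.
rewrite mcoeffM big1 // => k _; case: (lerP (psi k) 0) => k0.
  by rewrite pF ?mul0r.
by rewrite pH ?mulr0 // raddfB /= subr_le0 (le_trans m0) // ltW.
Qed.

Lemma psi_pos_prod (I : Type) (r : seq I) (P : pred I) (E : I -> {fps {galg K[G]}}) :
  (forall i, P i -> psi_pos (E i - 1)) -> psi_pos (\prod_(i <- r | P i) E i - 1).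
Proof.
move=> pE; apply: (big_ind (fun F => psi_pos (F - 1))) => //.
  by move=> j m _; rewrite subrr mcoeff0.
move=> F H pF pH; have -> : F * H - 1 = (F - 1) * (H - 1) + ((F - 1) + (H - 1)) by ring.
by apply: psi_posD; [apply: psi_posM | apply: psi_posD].
Qed.

End FpsMcoeff.

(** * The kernel C(t), factor by factor *)

Definition kernel_factor (K : comNzRingType) (G : zmodType) (k : G) : {fps {galg K[G]}} :=
  Fps (fun j => gexp (k *+ j) - gexp (k *+ j.+1)).

(** Geometric series. With explicit coefficients, supports and the action of reflections can be read
    off term by term. *)
Lemma kernel_factorE (K : comNzRingType) (G : zmodType) (k : G) :
  (1 - fpsC (gexp k)) / (1 - fpsX * fpsC (gexp k)) = kernel_factor K k.
Proof.
have geomE := fpsX_geom (gexp k : {galg K[G]}).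
apply: (mulIr (fps_unit_geom (gexp k : {galg K[G]}))).
have -> : kernel_factor K k =
    (1 - fpsC (gexp k)) * Fps (fun j => (gexp k : {galg K[G]}) ^+ j).
  apply: fpsP => j; rewrite mulrBl mul1r fcoefB fcoefCM /=.
  by rewrite !gexpMn exprS.
by rewrite mulrVK ?fps_unit_geom // -mulrA [X in _ * X]mulrC geomE mulr1.
Qed.

Lemma psi_pos_kernel_factor (K : comNzRingType) (G : zmodType) (psi : {additive G -> int}) k :
  0 < psi k -> psi_pos psi (kernel_factor K k - 1).
Proof.
move=> k0 j m m0; have E i : (0 < i)%N -> (gexp (k *+ i) : {galg K[G]})@_m = 0.
  move=> i0; rewrite mcoeffU; case: eqP => // E; move: m0.
  by rewrite -E raddfMn /= pmulrn_lle0 // leNgt k0.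
rewrite fcoefB fcoef1 /=; case: j => [|j].
  by rewrite mulr0n gexp0 addrC addrA addNr add0r mcoeffN E ?oppr0.
by rewrite subr0 mcoeffB !E ?subr0.
Qed.

Lemma map_fps_kernel_factor (K : comNzRingType) (G : zmodType) (s : G -> G) k :
  {morph s : k l / k + l} -> s 0 = 0 -> involutive s ->
  map_fps (gperm s) (kernel_factor K k) = kernel_factor K (s k).
Proof.
move=> sD s0 sK; apply: fpsP => j /=; rewrite gpermB // !gperm_gexp //.
have sMn i : s (k *+ i) = s k *+ i.
  by elim: i => [|i IH]; rewrite ?mulr0n // !mulrS sD IH.
by rewrite !sMn.
Qed.

Lemma cherednik_kernelE n : cherednik_kernel n =
  \prod_(p : 'I_n.+1 * 'I_n.+1 | (p.1 < p.2)%N) kernel_factor rat (root p).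
Proof. by apply: eq_bigr => p _; rewrite kernel_factorE. Qed.

Definition kcoef n (mu : weight n) : {fps rat} := fps_mcoeff mu (cherednik_kernel n).

(** Here [e] and [e'] stand for e^alpha and e^(-alpha), and [sC] for the reflected kernel. Both
    kernels share the cofactor [D]; eliminating it gives (X - e) sC = (1 - X e) C. *)
Lemma reflected_factor (R : comUnitRingType) (X e e' C sC D : R) :
  e * e' = 1 -> 1 - X * e \is a GRing.unit -> 1 - X * e' \is a GRing.unit ->
  C = (1 - e) / (1 - X * e) * D -> sC = (1 - e') / (1 - X * e') * D ->
  X * sC - e * sC = C - X * (e * C).
Proof.
move=> ee1 U U' CE sCE.
have C1 : C * (1 - X * e) = (1 - e) * D by rewrite CE mulrAC mulrVK.
have C2 : sC * (1 - X * e') = (1 - e') * D by rewrite sCE mulrAC mulrVK.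
have -> : X * sC - e * sC = - e * (sC * (1 - X * e')) + X * sC * (1 - e * e') by ring.
have -> : C - X * (e * C) = C * (1 - X * e) by ring.
rewrite C1 C2 ee1.
have -> : - e * ((1 - e') * D) + X * sC * (1 - 1) = (e * e' - e) * D by ring.
by rewrite ee1.
Qed.

(** * The reflection identity for the coefficients of C(t) *)

Section Reflection.
Variables (n : nat) (i : 'I_n).
Local Notation tau := (tperm (inord i : 'I_n.+1) (inord i.+1)).
Local Notation alpha := (root (inord i, inord i.+1) : weight n).

Lemma coord_srefl (lam : weight n) j : coord (srefl i lam) j = coord lam (tau j).
Proof. by rewrite /coord mxE. Qed.

Lemma weightP (lam mu : weight n) : coord lam =1 coord mu -> lam = mu.
Proof. by move=> E; apply/val_inj/rowP => j; apply: E. Qed.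

Lemma coordD (lam mu : weight n) j : coord (lam + mu) j = coord lam j + coord mu j.
Proof. by rewrite /coord mxE. Qed.

Lemma coordB (lam mu : weight n) j : coord (lam - mu) j = coord lam j - coord mu j.
Proof. by rewrite /coord !mxE. Qed.

Lemma coord_zero j : coord (0 : weight n) j = 0.
Proof. by rewrite /coord mxE. Qed.

Lemma coord_root (p : 'I_n.+1 * 'I_n.+1) j :
  coord (root p) j = (j == p.1)%:R - (j == p.2)%:R.
Proof. by rewrite /coord !mxE eqxx. Qed.

Lemma sreflD : {morph (srefl i : weight n -> weight n) : lam mu / lam + mu}.
Proof. by move=> lam mu; apply: weightP => j; rewrite !(coordD, coord_srefl). Qed.

Lemma srefl0 : srefl i 0 = 0 :> weight n.
Proof. by apply: weightP => j; rewrite coord_srefl !coord_zero. Qed.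

Lemma sreflK : involutive (srefl i : weight n -> weight n).
Proof. by move=> lam; apply: weightP => j; rewrite !coord_srefl tpermK. Qed.

Lemma srefl_root p : srefl i (root p) = root (tau p.1, tau p.2).
Proof.
apply: weightP => j; rewrite coord_srefl !coord_root /=.
by rewrite -!(inj_eq (@perm_inj _ tau) (tau j)) !tpermK.
Qed.

Lemma val_tau (c : 'I_n.+1) :
  tau c = (if c == i :> nat then i.+1 else if c == i.+1 :> nat then nat_of_ord i else c) :> nat.
Proof.
have i1 : (i < n.+1)%N by have := ltn_ord i; lia.
have i2 : (i.+1 < n.+1)%N by have := ltn_ord i; lia.
case: tpermP => [->|->|/eqP c1 /eqP c2]; rewrite ?inordK ?eqxx //.
    by case: eqP => //; lia.
  by rewrite -!val_eqE /= !inordK // in c1 c2; rewrite (negPf c1) (negPf c2).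
Qed.

(** A simple reflection permutes the positive roots other than its own, so it fixes the cofactor
    [D]. *)
Lemma srefl_morph_kernel (phi : {fps {galg rat[weight n]}} -> {fps {galg rat[weight n]}}) :
  {morph phi : F H / F * H} -> phi 1 = 1 ->
  (forall k, phi (kernel_factor rat k) = kernel_factor rat (srefl i k)) ->
  let D := \prod_(p : 'I_n.+1 * 'I_n.+1 |
    (p.1 < p.2)%N && (p != (inord i, inord i.+1))) kernel_factor rat (root p) in
  phi (kernel_factor rat alpha * D) = kernel_factor rat (- alpha) * D.
Proof.
move=> phiM phi1 phi_factor /=.
have i1 : (i < n.+1)%N by have := ltn_ord i; lia.
have i2 : (i.+1 < n.+1)%N by have := ltn_ord i; lia.
rewrite phiM.
rewrite phi_factor.
rewrite (big_morph phi phiM phi1).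
have -> : srefl i alpha = - alpha.
  rewrite srefl_root tpermL tpermR; apply: weightP => j.
  by rewrite -[- alpha]sub0r coordB coord_zero !coord_root /=; ring.
congr (_ * _).
have tinj : injective (fun p : 'I_n.+1 * 'I_n.+1 => (tau p.1, tau p.2)).
  by move=> [a b] [c d] /= [/perm_inj -> /perm_inj ->].
rewrite [RHS](reindex_inj tinj) /=; apply: eq_big => [p|p _]; last first.
  by rewrite phi_factor srefl_root.
case: p => a b; rewrite /= !xpair_eqE.
rewrite -!val_eqE /= !val_tau !inordK //.
by do ![case: eqP => ?]; lia.
Qed.

Lemma kernel_srefl :
  exists D, cherednik_kernel n = kernel_factor rat alpha * D /\
    map_fps (gperm (srefl i)) (cherednik_kernel n) = kernel_factor rat (- alpha) * D.
Proof.
have i1 : (i < n.+1)%N by have := ltn_ord i; lia.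
have i2 : (i.+1 < n.+1)%N by have := ltn_ord i; lia.
pose p0 : 'I_n.+1 * 'I_n.+1 := (inord i, inord i.+1).
have p0lt : (p0.1 < p0.2)%N by rewrite /= !inordK.
exists (\prod_(p : 'I_n.+1 * 'I_n.+1 | (p.1 < p.2)%N && (p != p0)) kernel_factor rat (root p)).
have E : cherednik_kernel n = kernel_factor rat alpha *
    \prod_(p : 'I_n.+1 * 'I_n.+1 | (p.1 < p.2)%N && (p != p0)) kernel_factor rat (root p).
  by rewrite cherednik_kernelE (bigD1 p0).
split; first exact: E.
rewrite {}E.
apply: (srefl_morph_kernel (phi := map_fps (gperm (srefl i)))) => //.
- by apply: map_fpsM; [apply: gpermD | apply: gpermM | apply: gperm0];
    first [exact: sreflK | exact: sreflD].
- apply: fpsP => -[|j] /=; last by rewrite gperm0 //; exact: sreflK.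
  by rewrite -gexp0 gperm_gexp ?srefl0 //; exact: sreflK.
- by move=> k; apply: map_fps_kernel_factor; [exact: sreflD|exact: srefl0|exact: sreflK].
Qed.

(** Coefficient of e^mu in the identity of [reflected_factor]; the coefficients of the reflected
    kernel are those of C(t) at reflected weights. *)
Lemma kcoef_srefl (mu : weight n) :
  fpsX * kcoef (srefl i mu) - kcoef (srefl i mu + alpha) =
  kcoef mu - fpsX * kcoef (mu - alpha).
Proof.
have [D [CE sCE]] := kernel_srefl.
have sK : involutive (srefl i : weight n -> weight n) := sreflK.
have sCcoef m : fps_mcoeff m (map_fps (gperm (srefl i)) (cherednik_kernel n)) =
    kcoef (srefl i m).
  by apply: fpsP => j; rewrite fcoef_mcoeff [fcoef (map_fps _ _) j]/(gperm _ _) gpermE.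
move: sCE sCcoef; rewrite /kcoef; move: CE.
move: (map_fps _ _) => sC; move: (cherednik_kernel n) => C.
rewrite -!kernel_factorE => CE sCE sCcoef.
have ee1 : fpsC (gexp alpha) * fpsC (gexp (- alpha)) = 1 :> {fps {galg rat[weight n]}}.
  by apply: fpsP => k; rewrite fcoefCM; case: k => [|k] /=; rewrite ?mulr0 // -gexpD subrr.
have := fps_mcoeff_reflection mu
  (reflected_factor ee1 (fps_unit_geom _) (fps_unit_geom _) CE sCE).
rewrite !sCcoef.
suff -> : srefl i (mu - alpha) = srefl i mu + alpha by [].
apply: weightP => j; rewrite !(coord_srefl, coordB, coordD, coord_root) /=.
have S a : (tau j == a) = (j == tau a) by rewrite -(inj_eq (@perm_inj _ tau)) tpermK.
by rewrite !S tpermL tpermR; ring.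
Qed.

End Reflection.

(** Every factor of C(t) is 1 plus terms on which psi is positive, so outside that half-space only
    the constant 1 contributes. *)
Lemma kcoef_psi n (psi : {additive weight n -> int}) (mu : weight n) :
  (forall p : 'I_n.+1 * 'I_n.+1, (p.1 < p.2)%N -> 0 < psi (root p)) ->
  psi mu <= 0 -> kcoef mu = (mu == 0)%:R.
Proof.
move=> psi_root mu0; apply: fpsP => j; rewrite fcoef_mcoeff cherednik_kernelE.
have P : psi_pos psi (\prod_(p : 'I_n.+1 * 'I_n.+1 | (p.1 < p.2)%N)
    kernel_factor rat (root p) - 1).
  apply: psi_pos_prod => p lt_p.
  exact: psi_pos_kernel_factor (psi_root p lt_p).
have := P j mu mu0; rewrite fcoefB mcoeffB => /eqP; rewrite subr_eq0 => /eqP ->.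
have -> : fcoef ((mu == 0)%:R : {fps rat}) j = ((mu == 0) && (j == 0%N))%:R.
  by case: eqP => // _; rewrite fcoef1.
rewrite fcoef1; case: j => [|j]; last by rewrite andbF mcoeff0.
by rewrite andbT -[1%:R]/(gexp 0) mcoeffU eq_sym.
Qed.

(** * Weights as integer sequences *)

Section WeightsAsSequences.
Variable n : nat.
Implicit Types (lam mu : weight n) (s u v : seq int).

Definition wsum (c : 'I_n.+1 -> int) lam : int := \sum_i c i * coord lam i.

Fact wsum_zmod c : zmod_morphism (wsum c).
Proof. by move=> lam mu; rewrite -sumrB; apply: eq_bigr => i _; rewrite coordB mulrBr. Qed.
HB.instance Definition _ c := GRing.isZmodMorphism.Build (weight n) int (wsum c) (wsum_zmod c).

Lemma wsum_root c p : wsum c (root p) = c p.1 - c p.2.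
Proof.
have S a : \sum_i c i * (i == a)%:R = c a.
  by rewrite (bigD1 a) //= eqxx mulr1 big1 ?addr0 // => i /negPf ->; rewrite mulr0.
rewrite -[in RHS](S p.1) -[in RHS](S p.2) -sumrB.
by apply: eq_bigr => i _; rewrite coord_root mulrBr.
Qed.

Lemma sum_coord lam : \sum_i coord lam i = 0.
Proof. exact: eqP (valP lam). Qed.

Lemma sum_pairs_gt (c : 'I_n.+1 -> int) :
  \sum_(p : 'I_n.+1 * 'I_n.+1 | (p.1 < p.2)%N) c p.1 = \sum_i c i *+ (n - i).
Proof.
rewrite -(pair_big_dep xpredT (fun a b : 'I_n.+1 => (a < b)%N) (fun a b => c a)) /=.
apply: eq_bigr => i _; rewrite sumr_const; congr (_ *+ _).
have := cardC [pred j : 'I_n.+1 | (j < i.+1)%N]; rewrite card_ord.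
rewrite -sum1_card -(big_ord_widen _ (fun=> 1%N) (ltn_ord i)) sum1_card card_ord.
have ile := ltn_ord i; move=> E; apply: (@addnI i.+1).
have -> : (i.+1 + (n - i) = n.+1)%N by lia.
rewrite -[RHS]E.
by congr (_ + _)%N; apply: eq_card => j; rewrite !inE ltnS -ltnNge.
Qed.

Lemma sum_pairs_lt (c : 'I_n.+1 -> int) :
  \sum_(p : 'I_n.+1 * 'I_n.+1 | (p.1 < p.2)%N) c p.2 = \sum_i c i *+ i.
Proof.
rewrite -(pair_big_dep xpredT (fun a b : 'I_n.+1 => (a < b)%N) (fun a b => c b)) /=.
rewrite (exchange_big_dep xpredT) //=; apply: eq_bigr => i _.
by rewrite -(big_ord_widen _ (fun=> c i) (ltnW (ltn_ord i))) sumr_const card_ord.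
Qed.

(** The height as an integer: with positions counted from 0, rho has coordinates n/2 - i, and n/2
    disappears because the coordinates of a weight sum to 0. *)
Definition wht := wsum (fun i => - (i : nat)%:Z).
HB.instance Definition _ := GRing.isZmodMorphism.Build (weight n) int wht (wsum_zmod _).

Lemma htE lam : ht lam = (wht lam)%:~R.
Proof.
rewrite ht_def -rmorph_sum sumrB sum_pairs_gt sum_pairs_lt.
have -> : \sum_i coord lam i *+ (n - i) - \sum_i coord lam i *+ i = 2%:Z * wht lam.
  have Z : \sum_i n%:Z * coord lam i = 0 by rewrite -mulr_sumr sum_coord mulr0.
  rewrite /wht /wsum mulr_sumr -sumrB -[RHS]addr0.
  rewrite -[X in _ = _ + X]Z -big_split /=.
  have conv (x : int) k : x *+ k = x * k%:Z by rewrite -mulr_natr natz.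
  apply: eq_bigr => i _; rewrite !conv.
  have -> : (n - i)%:Z = n%:Z - i%:Z by have := ltn_ord i; lia.
  ring.
by rewrite rmorphM /= mulKf.
Qed.

Lemma wht_root p : wht (root p) = p.2%:Z - p.1%:Z.
Proof. by rewrite /wht wsum_root; ring. Qed.

Definition valid s := (size s == n.+1) && (\sum_(x <- s) x == 0).

Definition seq_of lam : seq int := [seq coord lam i | i <- enum 'I_n.+1].
Definition wof s : weight n := insubd 0 (\row_i nth 0 s i).

Lemma valid_seq_of lam : valid (seq_of lam).
Proof. by rewrite /valid size_map size_enum_ord eqxx big_map big_enum /= sum_coord. Qed.

Lemma coord_wof s i : valid s -> coord (wof s) i = nth 0 s i.
Proof.
case/andP => /eqP szs /eqP s0; rewrite /coord /wof insubdK ?mxE //.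
apply/eqP; rewrite -[RHS]s0 [RHS](big_nth 0) szs big_mkord.
by apply: eq_bigr => j _; rewrite mxE.
Qed.

Lemma nth_seq_of lam (i : 'I_n.+1) : nth 0 (seq_of lam) i = coord lam i.
Proof. by rewrite (nth_map i) ?size_enum_ord // nth_ord_enum. Qed.

Lemma size_seq_of lam : size (seq_of lam) = n.+1.
Proof. by rewrite size_map size_enum_ord. Qed.

Lemma seq_ofK : cancel seq_of wof.
Proof. by move=> lam; apply: weightP => i; rewrite coord_wof ?valid_seq_of // nth_seq_of. Qed.

Lemma wofK s : valid s -> seq_of (wof s) = s.
Proof.
move=> vs; have /andP[/eqP szs _] := vs.
apply: (eq_from_nth (x0 := 0)); rewrite size_seq_of ?szs // => i lti.
by rewrite (nth_seq_of _ (Ordinal lti)) coord_wof.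
Qed.

Lemma perm_valid s s' : perm_eq s s' -> valid s = valid s'.
Proof. by move=> E; rewrite /valid (perm_size E) (perm_big _ E). Qed.

Lemma valid_two u w v (x y x' y' : int) : x + y = x' + y' ->
  valid (u ++ x :: w ++ y :: v) = valid (u ++ x' :: w ++ y' :: v).
Proof.
move=> E; rewrite /valid !size_cat /= !size_cat /=; congr (_ && (_ == _)).
rewrite !big_cat !big_cons /= !big_cat !big_cons /=.
have -> : x = x' + y' - y by rewrite -E addrK.
ring.
Qed.

Lemma nth_two u w v (x y : int) j : nth 0 (u ++ x :: w ++ y :: v) j =
  if j == size u then x else
  if j == (size u + size w).+1 then y else nth 0 (u ++ 0 :: w ++ 0 :: v) j.
Proof.
rewrite !nth_cat; have [lt|ge] := ltnP j (size u).
  by rewrite !ifN //; apply/eqP; lia.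
rewrite -(subnKC ge) -addnS eqn_add2l addKn; case: (j - size u)%N => [|k] /=.
  by rewrite addn0 eqxx.
rewrite eqSS ifN; last by apply/eqP; lia.
rewrite !nth_cat; case: ltngtP => [//|lt|->]; last by rewrite subnn.
by have -> : (k - size w = (k - size w).-1.+1)%N by lia.
Qed.

Lemma valid_pair u v (x y x' y' : int) : x + y = x' + y' ->
  valid (u ++ x :: y :: v) = valid (u ++ x' :: y' :: v).
Proof. exact: (valid_two u [::] v). Qed.

Lemma nth_pair u v (x y : int) j : nth 0 (u ++ x :: y :: v) j =
  if j == size u then x else if j == (size u).+1 then y else nth 0 (u ++ 0 :: 0 :: v) j.
Proof. by rewrite (nth_two u [::]) addn0. Qed.

Lemma valid_pair_size u v (x y : int) : valid (u ++ x :: y :: v) -> (size u < n)%N.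
Proof. by case/andP => /eqP; rewrite size_cat /= => E _; lia. Qed.

Lemma srefl_wof u v (x y : int) (ltu : (size u < n)%N) : valid (u ++ x :: y :: v) ->
  srefl (Ordinal ltu) (wof (u ++ x :: y :: v)) = wof (u ++ y :: x :: v).
Proof.
move=> vs; have vs' : valid (u ++ y :: x :: v) by rewrite (valid_pair _ _ (addrC y x)).
apply: weightP => j; rewrite coord_srefl !coord_wof // val_tau /=.
rewrite [LHS]nth_pair [RHS]nth_pair.
case: (eqVneq (nat_of_ord j) (size u)) => [ju|ju].
  by rewrite eqxx (gtn_eqF (ltnSn _)).
case: (eqVneq (nat_of_ord j) (size u).+1) => [ju1|ju1]; first by rewrite eqxx.
by rewrite (negPf ju) (negPf ju1).
Qed.

Definition simple_root (i : 'I_n) : weight n := root (inord i, inord i.+1).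

Lemma coordMn lam k j : coord (lam *+ k) j = coord lam j *+ k.
Proof. by elim: k => [|k IH]; [rewrite !mulr0n coord_zero|rewrite !mulrS coordD IH]. Qed.

Lemma wof_add_root u w v (x y : int) k : valid (u ++ x :: w ++ y :: v) ->
  wof (u ++ x :: w ++ y :: v) +
    (root (inord (size u), inord (size u + size w).+1) : weight n) *+ k =
  wof (u ++ (x + k%:Z) :: w ++ (y - k%:Z) :: v).
Proof.
move=> vs.
have E : x + y = x + k%:Z + (y - k%:Z) by ring.
have vs' : valid (u ++ (x + k%:Z) :: w ++ (y - k%:Z) :: v) by rewrite -(valid_two _ _ _ E).
have szs : (size u + size w < n)%N.
  by case/andP: vs => /eqP; rewrite size_cat /= size_cat /= => + _; lia.
have szu : (size u < n.+1)%N by lia.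
apply: weightP => j; rewrite coordD coordMn !coord_wof // coord_root.
rewrite [X in X + _]nth_two [RHS]nth_two -!val_eqE /= !inordK //.
have conv (z : int) : z *+ k = z * k%:Z by rewrite -mulr_natr natz.
rewrite conv; case: (eqVneq (nat_of_ord j) (size u)) => [->|ju].
  by rewrite -addnS -[X in X == _]addn0 eqn_add2l mulr1n mulr0n; ring.
by case: eqP => _; rewrite ?mulr1n ?mulr0n; ring.
Qed.

Lemma wof_add_simple_root u v (x y : int) (ltu : (size u < n)%N) k : valid (u ++ x :: y :: v) ->
  wof (u ++ x :: y :: v) + simple_root (Ordinal ltu) *+ k =
  wof (u ++ (x + k%:Z) :: (y - k%:Z) :: v).
Proof. by move=> vs; rewrite -(wof_add_root (w := [::]) k vs) addn0. Qed.

(** Extended by 0, so that the exchange identities hold for all sequences: they only compare words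
    of equal length and equal sum. *)
Definition fcoeff s : {fps rat} := if valid s then kcoef (wof s) else 0.

(** [kcoef_srefl] read on two adjacent coordinates: reflecting gives (y, x), then adding alpha gives
    (y+1, x-1), while mu - alpha has (x-1, y+1). *)
Lemma fcoeff_pair u v (x y : int) :
  fcoeff (u ++ x :: y :: v) + fcoeff (u ++ (y + 1) :: (x - 1) :: v) =
  fpsX * (fcoeff (u ++ y :: x :: v) + fcoeff (u ++ (x - 1) :: (y + 1) :: v)).
Proof.
have V1 : valid (u ++ y :: x :: v) = valid (u ++ x :: y :: v).
  by apply: valid_pair; ring.
have V2 : valid (u ++ (y + 1) :: (x - 1) :: v) = valid (u ++ x :: y :: v).
  by apply: valid_pair; ring.
have V3 : valid (u ++ (x - 1) :: (y + 1) :: v) = valid (u ++ x :: y :: v).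
  by apply: valid_pair; ring.
rewrite /fcoeff V1 V2 V3; case: ifP => [vs|_]; last by rewrite !addr0 mulr0.
have ltu := valid_pair_size vs.
have := kcoef_srefl (Ordinal ltu) (wof (u ++ x :: y :: v)).
rewrite srefl_wof // -/(simple_root _) -[simple_root _]mulr1n wof_add_simple_root ?V1 //.
have -> : wof (u ++ x :: y :: v) - simple_root (Ordinal ltu) *+ 1 =
    wof (u ++ (x - 1) :: (y + 1) :: v).
  apply: (canLR (addrK _)); rewrite wof_add_simple_root ?V3 //.
  by congr (wof (u ++ _ :: _ :: v)); ring.
move: (kcoef _) (kcoef _) (kcoef _) (kcoef _) => d c b a E.
by rewrite mulrDr -[fpsX * a](subrK b) E; ring.
Qed.

Lemma fcoeff_final_gt0 u v : 0 < \sum_(x <- v) x -> fcoeff (u ++ v) = 0.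
Proof.
move=> v0; rewrite /fcoeff; case: ifP => // vs.
have /andP[/eqP szs _] := vs; move: szs; rewrite size_cat => szs.
pose final (i : 'I_n.+1) : int := (size u <= i)%N%:R.
have finalE : wsum final (wof (u ++ v)) = \sum_(x <- v) x.
  rewrite /wsum (eq_bigr (fun i : 'I_n.+1 =>
      if (size u <= i)%N then nth 0 (u ++ v) i else 0)); last first.
    by move=> i _; rewrite coord_wof // /final; case: ifP; rewrite ?mul1r ?mul0r.
  rewrite -big_mkcond /= -(big_mkord (fun i => size u <= i)%N (fun i => nth 0 (u ++ v) i)).
  rewrite (big_cat_nat (n := size u)) //=; last by lia.
  rewrite big_nat_cond big_pred0 ?add0r; last by move=> i; lia.
  rewrite [RHS](big_nth 0) -{1}[size u]add0n big_addn.
  have -> : (n.+1 - size u = size v)%N by lia.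
  apply: eq_big => [i|i _]; first by rewrite leq_addl.
  by rewrite nth_cat ltnNge leq_addl /= addnK.
(* The functional is the height minus [K] times the final sum. It is positive on positive roots,
   whose final sums are at most 0; on the given weight the final sum is at least 1, and [K] is just
   large enough to make the value at most 0. *)
pose K := `|wht (wof (u ++ v))|.
pose c (i : 'I_n.+1) := - (i : nat)%:Z - K * final i.
have cE lam : wsum c lam = wht lam - K * wsum final lam.
  rewrite /wht /wsum mulr_sumr -sumrB; apply: eq_bigr => i _.
  by rewrite /c; ring.
rewrite (kcoef_psi (psi := wsum c)).
- case: eqP => // w0; move: v0; rewrite -finalE w0.
  by rewrite raddf0 ltxx.
- move=> p lt_p; rewrite /= cE wht_root wsum_root.
  have : final p.1 - final p.2 <= 0.
    by rewrite /final subr_le0; case: (leqP _ p.1) => // H; rewrite (leq_trans H (ltnW lt_p)).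
  have : 0 <= K by exact: normr_ge0.
  by nia.
- rewrite /= cE finalE subr_le0; apply: le_trans (ler_norm _) _.
  by rewrite -/K ler_peMr ?normr_ge0.
Qed.

Lemma valid_zeros : valid (nseq n.+1 0).
Proof.
rewrite /valid size_nseq eqxx big1_seq // => x /andP[_].
by rewrite mem_nseq => /andP[_ /eqP].
Qed.

Lemma wof_zeros : wof (nseq n.+1 0) = 0.
Proof. by apply: weightP => i; rewrite coord_wof ?valid_zeros // coord_zero nth_nseq if_same. Qed.

Lemma fcoeff_zeros : fcoeff (nseq n.+1 0) = 1.
Proof.
rewrite /fcoeff valid_zeros wof_zeros (kcoef_psi (psi := wht)) ?eqxx ?raddf0 //.
by move=> p lt_p; rewrite /= wht_root; lia.
Qed.

(** For the pair 0, -1 the two terms on each side of [fcoeff_pair] coincide, and the factor 2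
    cancels over the rationals. *)
Lemma fcoeff_swap0 u v :
  fcoeff (u ++ 0 :: -1 :: v) = fpsX * fcoeff (u ++ -1 :: 0 :: v).
Proof.
have := fcoeff_pair u v 0 (-1); rewrite addNr sub0r -!mulr2n mulrnAr => E.
apply: fpsP => k; have := congr1 (fun F => fcoef F k) E.
by rewrite !mulr2n !fcoefD; lra.
Qed.

Lemma fcoeff_swapS u v (x : nat) :
  fcoeff (u ++ x.+1%:Z :: -1 :: v) + fcoeff (u ++ 0 :: x%:Z :: v) =
  fpsX * (fcoeff (u ++ -1 :: x.+1%:Z :: v) + fcoeff (u ++ x%:Z :: 0 :: v)).
Proof.
by have := fcoeff_pair u v x.+1%:Z (-1); rewrite addNr -[x.+1]addn1 PoszD addrK.
Qed.

End WeightsAsSequences.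

(** * Shuffles as words with prescribed nonnegative and negative parts *)

Lemma mem_shuffle a N (s : seq int) : (s \in shuffle a N) =
  ([seq x <- s | 0 <= x] == map Posz a) && ([seq x <- s | x < 0] == nseq N (-1)).
Proof.
elim: a N s => [|x a IHa] N s.
  rewrite mem_seq1; elim: s N => [|y s IHs] N; first by case: N.
  case: N => [|N] /=; first by case: (ltrP y 0) => y0 /=; rewrite ?andbF.
  rewrite eqseq_cons; case: (ltrP y 0) => y0 /=; first by rewrite eqseq_cons IHs andbCA.
  by case: eqP y0 => // ->.
elim: N s => [|N IHN] s.
  rewrite shuffle0 mem_seq1; elim: s (x :: a) => [|y s IHs] b; first by case: b.
  case: b => [|z b] /=; first by case: (ltrP y 0) => y0 /=; rewrite ?andbF.
  rewrite eqseq_cons; case: (ltrP y 0) => y0 /=; last by rewrite eqseq_cons IHs andbA.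
  by rewrite andbF; case: eqP y0 => // ->.
have -> : shuffle (x :: a) N.+1 =
  map (cons x%:Z) (shuffle a N.+1) ++ map (cons (-1)) (shuffle (x :: a) N) by [].
have mem_cons (z : int) L y s' : (y :: s' \in map (cons z) L) = (y == z) && (s' \in L).
  apply/mapP/andP => [[w wL [-> ->]]|[/eqP -> sL]]; first by rewrite eqxx.
  by exists s'.
rewrite mem_cat; case: s => [|y s].
  by apply/negbTE/negP => /orP[] /mapP[].
rewrite !mem_cons IHa IHN /=; case: (ltrP y 0) => y0 /=.
  have -> : (y == x%:Z) = false by apply/negP => /eqP E; rewrite E in y0.
  by rewrite /= [in RHS]eqseq_cons andbCA.
have -> : (y == -1) = false by apply/negP => /eqP E; rewrite E in y0.
by rewrite /= orbF [in RHS]eqseq_cons andbA.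
Qed.

Lemma shuffle_uniq a N : uniq (shuffle a N).
Proof.
have consI (z : int) : injective (cons z) by move=> u v [].
elim: a N => [|x a IHa] N //; elim: N => [|N IHN] //.
have -> : shuffle (x :: a) N.+1 =
  map (cons x%:Z) (shuffle a N.+1) ++ map (cons (-1)) (shuffle (x :: a) N) by [].
rewrite cat_uniq !map_inj_uniq // IHa IHN andbT /=.
by apply/hasPn => _ /mapP[w _ ->]; apply/negP => /mapP[w' _ []].
Qed.

Lemma perm_nonneg_neg (s : seq int) :
  perm_eq s ([seq x <- s | 0 <= x] ++ [seq x <- s | x < 0]).
Proof.
rewrite perm_sym -[X in _ ++ X](eq_filter (a1 := predC (fun x : int => 0 <= x))).
  by rewrite perm_filterC.
by move=> x /=; rewrite ltNge.
Qed.

(** * Local orbits and quasi-dominant weights *)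

Section Orbits.
Variable n : nat.
Implicit Types (lam mu : weight n) (s u v : seq int).
Local Notation valid := (valid n).
Local Notation wof := (@wof n).

Lemma local_refl_wof u v (x y : int) (ltu : (size u < n)%N) : valid (u ++ x :: y :: v) ->
  local_refl (Ordinal ltu) (wof (u ++ x :: y :: v)) =
  wof (if (0 <= x) && (0 <= y) then u ++ x :: y :: v else u ++ y :: x :: v).
Proof.
move=> vs; rewrite /local_refl srefl_wof // !coord_wof //=.
rewrite !inordK ?ltnS //; last exact: ltnW.
rewrite [X in 0 <= X]nth_pair eqxx [X in _ && (0 <= X)]nth_pair eqxx (gtn_eqF (ltnSn _)).
by case: ifP.
Qed.

Lemma split_at lam (i : 'I_n) : exists u x y v,
  [/\ lam = wof (u ++ x :: y :: v), valid (u ++ x :: y :: v) & size u = i].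
Proof.
have szs := size_seq_of lam; have vs := valid_seq_of lam; have lti := ltn_ord i.
case E : (drop i (seq_of lam)) => [|x [|y v]].
- by have := size_drop i (seq_of lam); rewrite E szs /=; lia.
- by have := size_drop i (seq_of lam); rewrite E szs /=; lia.
exists (take i (seq_of lam)), x, y, v; rewrite -E cat_take_drop seq_ofK.
by split=> //; rewrite size_take szs; case: ifP; lia.
Qed.

Lemma local_reflK (i : 'I_n) : involutive (@local_refl n i).
Proof.
move=> lam; have [u [x [y [v [-> vs szu]]]]] := split_at lam i.
have ltu : (size u < n)%N by rewrite szu.
have -> : i = Ordinal ltu by apply: val_inj; rewrite /= szu.
rewrite local_refl_wof //; case: ifP => xy; first by rewrite local_refl_wof // xy.
by rewrite local_refl_wof ?(valid_pair _ _ _ (addrC y x)) // andbC xy.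
Qed.

(** The invariants of the local action: a swap involves a negative coordinate, so it never reorders
    the nonnegative ones. *)
Lemma local_orbit_filter lam mu : local_orbit lam mu ->
  perm_eq (seq_of mu) (seq_of lam) /\
  [seq x <- seq_of mu | 0 <= x] = [seq x <- seq_of lam | 0 <= x].
Proof.
case=> w ->; elim: w => [|i w [IHp IHf]] //=.
move: IHp IHf; move: (foldr _ _ _) => mu'.
have [u [x [y [v [-> vs szu]]]]] := split_at mu' i.
have ltu : (size u < n)%N by rewrite szu.
have -> : i = Ordinal ltu by apply: val_inj; rewrite /= szu.
rewrite wofK // => pm <-; rewrite local_refl_wof //; case: ifP => xy; first by rewrite wofK.
rewrite wofK ?(valid_pair _ _ _ (addrC y x)) //; split.
  apply: perm_trans pm; rewrite perm_cat2l.
  by apply/seq.permP => p /=; lia.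
by rewrite !filter_cat /=; move: xy; case: (0 <= x); case: (0 <= y).
Qed.

(** Apart from equality the height strictly grows, so a weight of maximal height in its orbit can
    only climb to itself. *)
Definition climbs s s' : Prop := local_orbit (wof s) (wof s') /\
  (s = s' \/ ht (wof s) < ht (wof s')).

Lemma local_orbit_trans lam mu nu :
  local_orbit lam mu -> local_orbit mu nu -> local_orbit lam nu.
Proof. by move=> [w ->] [w' ->]; exists (w' ++ w); rewrite foldr_cat. Qed.

Lemma local_orbit_sym lam mu : local_orbit lam mu -> local_orbit mu lam.
Proof.
move=> [w ->]; exists (rev w); elim: w => [|i w IH] //=.
by rewrite rev_cons foldr_rcons local_reflK.
Qed.

Lemma climbs_refl s : climbs s s.
Proof. by split; [exists [::] | left]. Qed.

Lemma climbs_trans s1 s2 s3 : climbs s1 s2 -> climbs s2 s3 -> climbs s1 s3.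
Proof.
move=> [o1 h1] [o2 h2]; split; first exact: local_orbit_trans o1 o2.
case: h1 h2 => [->//|h1] [<-|h2]; first by right.
by right; apply: lt_trans h2.
Qed.

Lemma climbs_step u v (x : int) : 0 <= x -> valid (u ++ -1 :: x :: v) ->
  climbs (u ++ -1 :: x :: v) (u ++ x :: -1 :: v).
Proof.
move=> x0 vs; have ltu := valid_pair_size vs; split.
  by exists [:: Ordinal ltu] => /=; rewrite local_refl_wof.
right; rewrite !htE ltr_int.
(* The swap adds x + 1 times the simple root; the absolute value expresses this multiplicity as a
   natural number. *)
have -> : u ++ x :: -1 :: v = u ++ (-1 + (`|x| .+1)%:Z) :: (x - (`|x| .+1)%:Z) :: v.
  by congr (_ ++ _ :: _ :: _); lia.
rewrite -(wof_add_simple_root ltu) // raddfD raddfMn /= [X in X *+ _](wht_root (_, _)) /=.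
have i1 : (size u < n.+1)%N by exact: ltnW.
by rewrite !inordK ?ltnS // ltrDl pmulrn_lgt0 //; lia.
Qed.

Lemma climbs_past u b v : all (fun x : int => 0 <= x) b -> valid (u ++ -1 :: b ++ v) ->
  climbs (u ++ -1 :: b ++ v) (u ++ b ++ -1 :: v).
Proof.
elim: b u => [|x b IH] u; first by move=> _ _; exact: climbs_refl.
move=> /= /andP[x0 b0] vs; apply: climbs_trans (climbs_step x0 vs) _.
rewrite -!cat_rcons [rcons (rcons u x) _ ++ _]cat_rcons.
have := IH (rcons u x) b0; rewrite cat_rcons.
have -> : rcons u x ++ b ++ -1 :: v = u ++ x :: b ++ -1 :: v by rewrite cat_rcons.
rewrite !cat_rcons; apply.
by rewrite (valid_pair _ _ _ (addrC x (-1))).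
Qed.

(** Insertion sort from the right: once the tail is sorted, a leading -1 climbs past its nonnegative
    letters. *)
Lemma climbs_sort u s : all (fun x : int => -1 <= x) s -> valid (u ++ s) ->
  climbs (u ++ s) (u ++ [seq x <- s | 0 <= x] ++ [seq x <- s | x < 0]).
Proof.
elim: s u => [|x s IH] u; first by move=> _ _; exact: climbs_refl.
move=> /= /andP[x1 s1] vs.
have C : climbs (u ++ x :: s)
    (u ++ x :: [seq x <- s | 0 <= x] ++ [seq x <- s | x < 0]).
  by rewrite -!cat_rcons; apply: IH; rewrite ?cat_rcons.
case: (ltrP x 0) => x0 //=.
have xE : x = -1 by lia.
apply: climbs_trans C _; rewrite xE; apply: climbs_past.
  by apply/allP => y; rewrite mem_filter => /andP[].
rewrite -xE; move: vs; rewrite (@perm_valid n _ (u ++ x ::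
  [seq y <- s | 0 <= y] ++ [seq y <- s | y < 0])) //.
by rewrite perm_cat2l perm_cons perm_nonneg_neg.
Qed.

(** Nonnegative coordinates that sum to 0 all vanish, so the two cases of first layer merge into one
    bound. *)
Lemma first_layerE lam : first_layer lam = all (fun x : int => -1 <= x) (seq_of lam).
Proof.
apply/idP/allP => [/first_layer_bounds fl _ /mapP[i _ ->]|ge1].
  by have /andP[] := fl i.
have ge1' i : -1 <= coord lam i by apply: ge1; apply: map_f; rewrite mem_enum.
rewrite /first_layer; have [//|lam0 /=] := eqVneq lam 0.
apply/andP; split; first exact/forallP.
apply: contraNT lam0 => /existsPn ne1.
have ge0 i : 0 <= coord lam i by have := ne1 i; have := ge1' i; lia.
apply/eqP/weightP => i; rewrite coord_zero; apply/eqP.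
have := sum_coord lam => /eqP; rewrite psumr_eq0 => [/allP/(_ i)|j _]; last exact: ge0.
by rewrite mem_index_enum => /(_ isT).
Qed.

Lemma neg_nseq (s : seq int) : all (fun x : int => -1 <= x) s ->
  [seq x <- s | x < 0] = nseq (size [seq x <- s | x < 0]) (-1).
Proof.
elim: s => //= x s IH /andP[x1 /IH {}IH]; case: ifP => //= x0.
by rewrite -IH; congr (_ :: _); lia.
Qed.

Definition sorted_wt a N := map Posz a ++ nseq N (-1).

Lemma sorted_wt_filter a N :
  [seq x <- sorted_wt a N | 0 <= x] = map Posz a /\
  [seq x <- sorted_wt a N | x < 0] = nseq N (-1).
Proof.
rewrite /sorted_wt !filter_cat !filter_nseq /= cats0; split.
  by apply/all_filterP/allP => _ /mapP[k _ ->].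
have -> : [seq x <- map Posz a | x < 0] = [::] by elim: a.
by rewrite mul1n.
Qed.

Lemma sorted_wt_ge a N : all (fun x : int => -1 <= x) (sorted_wt a N).
Proof.
by rewrite all_cat all_nseq /= orbT andbT; apply/allP => _ /mapP[k _ ->].
Qed.

(** Sorting climbs within the local orbit, so maximality of the height means that nothing moved. *)
Lemma quasi_dominant_sorted lam : quasi_dominant lam ->
  exists a N, valid (sorted_wt a N) /\ lam = wof (sorted_wt a N).
Proof.
move=> [fl max]; have ge1 : all (fun x : int => -1 <= x) (seq_of lam) by rewrite -first_layerE.
have vs := valid_seq_of lam.
have [orb] := climbs_sort (u := [::]) ge1 vs; rewrite !cat0s in orb *.
rewrite seq_ofK in orb *; case=> [E|]; last by rewrite ltNge max.
exists (map absz [seq x <- seq_of lam | 0 <= x]), (size [seq x <- seq_of lam | x < 0]).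
have -> : sorted_wt [seq `|i|%N | i <- seq_of lam & 0 <= i]
    (size [seq x <- seq_of lam | x < 0]) = seq_of lam.
  rewrite [RHS]E /sorted_wt -neg_nseq //; congr (_ ++ _).
  rewrite -map_comp map_id_in // => x; rewrite mem_filter /= => /andP[x0 _].
  by rewrite gez0_abs.
by rewrite seq_ofK.
Qed.

Lemma shuffle_perm a N s : s \in shuffle a N -> perm_eq s (sorted_wt a N).
Proof.
by rewrite mem_shuffle => /andP[/eqP E1 /eqP E2]; have := perm_nonneg_neg s; rewrite E1 E2.
Qed.

Lemma mem_shuffle_climbs a N s : valid s -> s \in shuffle a N -> climbs s (sorted_wt a N).
Proof.
move=> vs sin; have ge1 : all (fun x : int => -1 <= x) s.
  by rewrite (perm_all _ (shuffle_perm sin)) sorted_wt_ge.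
have := climbs_sort (u := [::]) ge1 vs.
by move: sin; rewrite mem_shuffle => /andP[/eqP -> /eqP ->].
Qed.

(** One direction is the invariance in [local_orbit_filter]; conversely every shuffle climbs to the
    sorted word, and orbits are symmetric. *)
Lemma local_orbit_shuffle a N mu : valid (sorted_wt a N) ->
  local_orbit (wof (sorted_wt a N)) mu <-> seq_of mu \in shuffle a N.
Proof.
move=> vs; split=> [/local_orbit_filter|sin]; last first.
  have [/local_orbit_sym orb _] := mem_shuffle_climbs (valid_seq_of mu) sin.
  by rewrite seq_ofK in orb.
rewrite wofK // => -[pm fm]; have [f1 f2] := sorted_wt_filter a N.
rewrite mem_shuffle fm f1 eqxx /=.
rewrite neg_nseq; last by rewrite (perm_all _ pm) sorted_wt_ge.
by rewrite size_filter (seq.permP pm) -size_filter f2 size_nseq.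
Qed.

Lemma sorted_quasi_dominant a N : valid (sorted_wt a N) ->
  quasi_dominant (wof (sorted_wt a N)).
Proof.
move=> vs; split=> [|mu]; first by rewrite first_layerE wofK // sorted_wt_ge.
move/(local_orbit_shuffle _ vs) => sin.
have [_] := mem_shuffle_climbs (valid_seq_of mu) sin.
by rewrite seq_ofK => -[<-|/ltW //]; rewrite seq_ofK.
Qed.

Lemma fsum_local_orbit (V : nmodType) a N (F : weight n -> V) : valid (sorted_wt a N) ->
  \sum_(mu \in local_orbit (wof (sorted_wt a N))) F mu =
  \sum_(s <- shuffle a N) F (wof s).
Proof.
move=> vs; have vsh s : s \in shuffle a N -> valid s.
  by move=> /shuffle_perm/perm_valid ->.
have u : uniq (map wof (shuffle a N)).
  rewrite map_inj_in_uniq ?shuffle_uniq // => s s' /vsh V1 /vsh V2 E.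
  by rewrite -(wofK V1) E wofK.
rewrite -(big_map wof xpredT F) (fsbig_seq _ _ u).
apply: eq_fsbigl; apply/seteqP; split=> mu /=.
  move/(local_orbit_shuffle _ vs) => sin; apply/mapP.
  by exists (seq_of mu); rewrite ?seq_ofK.
case/mapP => s sin ->; apply/(local_orbit_shuffle _ vs).
by rewrite wofK ?vsh.
Qed.

End Orbits.

(** * Canonical expressions and height sets *)

Lemma last_positive (a : seq nat) : (0 < sumn a)%N ->
  exists b x r, a = b ++ x.+1 :: nseq r 0%N.
Proof.
elim: a => // y a IH; case: (posnP (sumn a)) => [a0|/IH [b [x [r ->]]] _]; last first.
  by exists (y :: b), x, r.
rewrite /= a0 addn0; case: y => // y _; exists [::], y, (size a); congr (_ :: _).
by apply/natnseq0P; rewrite a0.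
Qed.

Section CanonicalExpression.
Variable n : nat.
Implicit Types (lam mu : weight n) (p q : 'I_n.+1 * 'I_n.+1).
Local Notation valid := (valid n).
Local Notation wof := (@wof n).

Lemma colengthE lam : colength lam = count (fun x : int => x < 0) (seq_of lam).
Proof. by rewrite /colength cardE /enum_mem size_filter /seq_of count_map enumT. Qed.

Lemma colength_sorted a N : valid (sorted_wt a N) -> colength (wof (sorted_wt a N)) = N.
Proof.
move=> vs; rewrite colengthE wofK // -size_filter.
by have [_ ->] := sorted_wt_filter a N; rewrite size_nseq.
Qed.

Lemma first_layerP lam : reflect (forall i, -1 <= coord lam i) (first_layer lam).
Proof.
apply: (iffP idP) => [/first_layer_bounds fl i|ge1]; first by have /andP[] := fl i.
by rewrite first_layerE; apply/allP => _ /mapP[i _ ->].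
Qed.

(** Only coordinates [p.1] and [p.2] change, by one each. Within the first layer the co-length drops
    exactly when [p.2] carries a -1 and [p.1] does not become one. *)
Lemma removableP lam p : first_layer lam ->
  reflect [/\ (p.1 < p.2)%N, 0 < coord lam p.1 & coord lam p.2 < 0] (removable lam p).
Proof.
move=> /first_layerP fl; rewrite /removable; have [lt12|] := boolP (p.1 < p.2)%N; last first.
  by move=> _; constructor=> -[].
have ne12 : p.1 != p.2 by apply: contraTneq lt12 => ->; rewrite ltnn.
have cE j : coord (lam - root p) j = coord lam j - ((j == p.1)%:R - (j == p.2)%:R).
  by rewrite coordB coord_root.
have c1 : coord (lam - root p) p.1 = coord lam p.1 - 1.
  by rewrite cE eqxx (negPf ne12) subr0.
have c2 : coord (lam - root p) p.2 = coord lam p.2 + 1.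
  by rewrite cE eqxx eq_sym (negPf ne12) sub0r opprK.
have c3 j : j != p.1 -> j != p.2 -> coord (lam - root p) j = coord lam j.
  by move=> /negPf j1 /negPf j2; rewrite cE j1 j2 subrr subr0.
rewrite /colength (cardD1 p.2 [pred i | coord lam i < 0]).
rewrite (cardD1 p.1 [pred i | coord (lam - root p) i < 0]) !inE c1.
have fl1 := fl p.1; have fl2 := fl p.2.
rewrite /=; apply: (iffP andP) => [[/first_layerP fl' /eqP card]|[_ pos1 neg2]].
  have neg2 : coord lam p.2 < 0.
    rewrite ltNge; apply/negP => pos2; move: card; rewrite (le_gtF pos2) add0n.
    apply/eqP; rewrite gtn_eqF // ltnS; apply: leq_trans (leq_addl _ _).
    apply: subset_leq_card; apply/fintype.subsetP => j; rewrite !inE => /andP[j2 jneg].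
    have j1 : j != p.1 by apply: contraTneq jneg => ->; have := fl' p.1; rewrite c1 -leNgt; lia.
    by rewrite j1 c3.
  (* If coordinate [p.1] were not positive, the first layer bound would make it 0; it would then
     become -1 and make up for the -1 removed at [p.2]. *)
  split=> //; rewrite ltNge; apply/negP => npos1; have := fl' p.1; rewrite c1 => ge0.
  have z1 : coord lam p.1 = 0 by lia.
  move: card; rewrite z1 neg2 sub0r add1n => -[]; apply/eqP; rewrite gtn_eqF // ltnS.
  apply: subset_leq_card; apply/fintype.subsetP => j; rewrite !inE => /andP[j2 jneg].
  have j1 : j != p.1 by apply: contraTneq jneg => ->; rewrite z1.
  by rewrite j1 c3.
split.
  apply/first_layerP => j; have [->|j1] := eqVneq j p.1; first by rewrite c1; lia.
  by have [->|j2] := eqVneq j p.2; [rewrite c2; lia | rewrite c3].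
rewrite neg2 add1n eqSS; have -> : (coord lam p.1 - 1 < 0) = false by lia.
rewrite add0n; apply/eqP/eq_card => j; rewrite !inE.
have [->|j1] := eqVneq j p.1; first by rewrite ne12 /= ltNge ltW.
have [->|j2] := eqVneq j p.2; last by rewrite c3.
by rewrite c2; lia.
Qed.

Section LastRoot.
Variables (b : seq nat) (x r N : nat).
Let a := b ++ x.+1 :: nseq r 0%N.
Hypothesis va : valid (sorted_wt a N.+1).
(** With positions counted from 0, [size b] carries the rightmost positive coordinate, then come [r]
    zeros and the first -1; [p0] joins these two places. *)
Local Notation p0 := ((inord (size b), inord (size b + r).+1) : 'I_n.+1 * 'I_n.+1).

Let bound : (size b + r < n)%N.
Proof.
move: va => /andP[/eqP]; rewrite size_cat size_map size_nseq size_cat /= size_nseq.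
by move=> + _; lia.
Qed.

Lemma sorted_wtE y M : sorted_wt (b ++ y :: nseq r 0%N) M.+1 =
  map Posz b ++ y%:Z :: nseq r 0 ++ -1 :: nseq M (-1).
Proof. by rewrite /sorted_wt map_cat /= map_nseq -catA. Qed.

Lemma sorted_wtE0 y M : sorted_wt (b ++ y :: nseq r.+1 0%N) M =
  map Posz b ++ y%:Z :: nseq r 0 ++ 0 :: nseq M (-1).
Proof.
rewrite /sorted_wt -addn1 nseqD !map_cat /= map_cat map_nseq /=.
by rewrite -!catA /= -!catA.
Qed.

Lemma valid_lower : valid (sorted_wt (b ++ x :: nseq r.+1 0%N) N).
Proof.
move: va; rewrite /a sorted_wtE sorted_wtE0.
by rewrite (valid_two _ _ _ _ (x' := x%:Z) (y' := 0)) //; lia.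
Qed.

Lemma wof_lower :
  wof (sorted_wt a N.+1) - root p0 = wof (sorted_wt (b ++ x :: nseq r.+1 0%N) N).
Proof.
apply: (canLR (addrK _)); have := valid_lower; rewrite /a sorted_wtE sorted_wtE0 => vl.
have := wof_add_root 1 vl; rewrite size_map size_nseq mulr1n => ->.
by congr (wof (_ ++ _ :: _ ++ _ :: _)); lia.
Qed.

Lemma wht_p0 : wht (root p0) = r.+1%:Z.
Proof. by rewrite wht_root /= !inordK; lia. Qed.

Lemma coord_p0 : 0 < coord (wof (sorted_wt a N.+1)) p0.1 /\
  coord (wof (sorted_wt a N.+1)) p0.2 < 0.
Proof.
rewrite !coord_wof //= /a sorted_wtE !inordK ?ltnS //; last by lia.
rewrite [X in 0 < X]nth_two [X in X < 0]nth_two size_map size_nseq !eqxx.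
by rewrite ifN //; apply/eqP; lia.
Qed.

Lemma coord_pos_le i : 0 < coord (wof (sorted_wt a N.+1)) i -> (i <= size b)%N.
Proof.
rewrite coord_wof // /a sorted_wtE nth_cat size_map; case: ltnP; first by lia.
move=> bi; rewrite leqNgt -subn_gt0; case: (i - size b)%N => // k /=.
rewrite -[-1 :: _]/(nseq N.+1 (-1)) nth_cat !nth_nseq size_nseq.
by case: ifP => // _; case: ifP.
Qed.

Lemma coord_neg_ge i : coord (wof (sorted_wt a N.+1)) i < 0 -> (size b + r < i)%N.
Proof.
rewrite coord_wof // /a sorted_wtE nth_cat size_map; case: ltnP => ib.
  by rewrite (nth_map 0%N).
rewrite -[in (_ < i)%N](subnKC ib); case: (i - size b)%N => [|k] //=.
rewrite nth_cat nth_nseq size_nseq; case: ltnP => // rk _.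
by rewrite addnS ltnS leq_add2l.
Qed.

(** Positive coordinates lie at positions up to [size b], negative ones beyond [size b + r]. So a
    removable root has height at least [r.+1], with equality for [p0] only, and the default in
    [last_root] is not reached. *)
Lemma last_root_sorted : last_root (wof (sorted_wt a N.+1)) = root p0.
Proof.
have fl : first_layer (wof (sorted_wt a N.+1)) by rewrite first_layerE wofK // sorted_wt_ge.
have [pos neg] := coord_p0.
have rem0 : removable (wof (sorted_wt a N.+1)) p0.
  by apply/removableP => //; split=> //; rewrite /= !inordK; lia.
rewrite /last_root; case: pickP => [p /andP[rp /forallP minp]|/(_ p0)] /=; last first.
  rewrite rem0 /= => /negbT /forallPn[q]; rewrite negb_imply => /andP[rq].
  move/(removableP _ fl): rq => [_ /coord_pos_le q1 /coord_neg_ge q2].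
  by rewrite !htE wht_p0 ler_int wht_root; lia.
move/(removableP _ fl): rp => [_ /coord_pos_le p1 /coord_neg_ge p2].
have := minp p0; rewrite rem0 /= !htE wht_p0 ler_int wht_root => le.
congr root; case: p p1 p2 le {minp} => i j /= p1 p2 le.
by congr (_, _); apply: val_inj; rewrite /= inordK; lia.
Qed.

Lemma height_set_sorted : height_set (wof (sorted_wt a N.+1)) =
  rcons (height_set (wof (sorted_wt (b ++ x :: nseq r.+1 0%N) N))) r.+1%:R.
Proof.
rewrite /height_set /canonical_expr !colength_sorted //; last exact: valid_lower.
by rewrite [canonical_expr_rec N.+1 _]/= last_root_sorted wof_lower map_rcons htE wht_p0.
Qed.

Lemma ht_sorted : ht (wof (sorted_wt a N.+1)) =
  r.+1%:R + ht (wof (sorted_wt (b ++ x :: nseq r.+1 0%N) N)).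
Proof. by rewrite -wof_lower !htE raddfB /= wht_p0 rmorphB /= addrC subrK. Qed.

End LastRoot.

(* The nonnegative coordinates of the quasi-dominant weight with height set
   [hs]. Heights decrease along a canonical expression, so [hs], which is
   increasing, starts with the height of its last root. *)
Fixpoint parts (hs : seq nat) : seq nat :=
  if hs is h :: hs' then
    let m := (size (parts hs')).-1 in incr_nth (take m (parts hs')) (m - h)
  else nseq n.+1 0%N.

Definition heights (hs : seq nat) : bool :=
  sorted ltn hs && all (fun h => 0 < h <= n)%N hs.

(** Undoes the removal of a last root of height [r.+1]: a final zero gives way to a new -1, and the
    entry before the [r.+1] zeros, at position [m - h], grows by one. *)
Lemma parts_step hs b y r : parts hs = b ++ y :: nseq r.+1 0%N ->
  parts (r.+1 :: hs) = b ++ y.+1 :: nseq r 0%N.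
Proof.
move=> E /=; rewrite E.
have -> : (size (b ++ y :: nseq r.+1 0%N)).-1 = size (b ++ y :: nseq r 0%N).
  by rewrite !size_cat /= !size_nseq !addnS.
have -> : b ++ y :: nseq r.+1 0%N = (b ++ y :: nseq r 0%N) ++ [:: 0%N].
  by rewrite -catA /= -[0%N :: nseq r 0%N]/(nseq r.+1 0%N) -addn1 nseqD.
rewrite take_size_cat //.
have -> : (size (b ++ y :: nseq r 0%N) - r.+1 = size b)%N.
  by rewrite size_cat /= size_nseq addnK.
by elim: b {E} => //= z b ->.
Qed.

(** The default [n.+1] of [head] turns the bound for an empty tail into h <= n. *)
Lemma heights_cons h hs : heights (h :: hs) ->
  [/\ heights hs, (0 < h <= n)%N & (h < head n.+1 hs)%N].
Proof.
rewrite /heights /= => /and3P[ph h0 ahs]; split=> //; first by rewrite (path_sorted ph).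
by case: hs ph ahs => [_ _|k hs /= /andP[]] //=; lia.
Qed.

(** After a step of height h + 1 exactly h zeros follow the incremented entry, which leaves room for
    any smaller height; the empty list leaves n + 1 zeros. *)
Lemma parts_zeros hs r : heights hs -> (r.+1 < head n.+1 hs)%N ->
  exists b y, parts hs = b ++ y :: nseq r.+1 0%N.
Proof.
elim: hs r => [|h hs IH] r.
  move=> _ /= rn; exists (nseq (n - r.+1) 0%N), 0%N.
  rewrite -[0%N :: nseq r.+1 0%N]/(nseq r.+2 0%N) -nseqD.
  by have -> : (n - r.+1 + r.+2 = n.+1)%N by lia.
move=> /heights_cons[hhs /andP[h0 hn] hlt] /= rh.
case: h h0 hn hlt rh => // h _ hn hlt rh.
have [b [y E]] := IH h hhs hlt.
rewrite -[incr_nth _ _]/(parts (h.+1 :: hs)) (parts_step E).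
exists (b ++ belast y.+1 (nseq (h - r.+1) 0%N)), (last y.+1 (nseq (h - r.+1) 0%N)).
rewrite -catA -[X in _ = _ ++ X]cat_rcons -lastI cat_cons.
rewrite -[0%N :: nseq r 0%N]/(nseq r.+1 0%N) -nseqD.
by have -> : (h - r.+1 + r.+1 = h)%N by lia.
Qed.

Lemma parts_cons r hs : heights (r.+1 :: hs) -> exists b y,
  parts hs = b ++ y :: nseq r.+1 0%N /\ parts (r.+1 :: hs) = b ++ y.+1 :: nseq r 0%N.
Proof.
move=> /heights_cons[hhs _ lt]; have [b [y E]] := parts_zeros hhs lt.
by exists b, y; split=> //; exact: parts_step.
Qed.

Definition height_wt hs := sorted_wt (parts hs) (size hs).

Lemma height_wt_nil : height_wt [::] = nseq n.+1 0.
Proof. by rewrite /height_wt /sorted_wt cats0 map_nseq. Qed.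

Lemma heights_ind (P : seq nat -> Prop) : P [::] ->
  (forall hs b y r, heights (r.+1 :: hs) -> P hs ->
     parts hs = b ++ y :: nseq r.+1 0%N -> parts (r.+1 :: hs) = b ++ y.+1 :: nseq r 0%N ->
     P (r.+1 :: hs)) ->
  forall hs, heights hs -> P hs.
Proof.
move=> P0 PS; elim=> // -[|r] hs IH hh; have [hhs] := heights_cons hh; first by [].
move=> _ _; have [b [y [E1 E2]]] := parts_cons hh.
exact: PS hh (IH hhs) E1 E2.
Qed.

Lemma valid_height_wt hs : heights hs -> valid (height_wt hs).
Proof.
elim/heights_ind => [|{}hs b y r _ IH E1 E2].
  by rewrite height_wt_nil valid_zeros.
move: IH; rewrite /height_wt E1 E2 sorted_wtE0 sorted_wtE.
by rewrite (valid_two _ _ _ _ (x' := y.+1%:Z) (y' := -1)) //; lia.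
Qed.

(** The reversal appears because a canonical expression ends with its last root, whose height is the
    head of [hs]. *)
Lemma height_set_height_wt hs : heights hs ->
  height_set (wof (height_wt hs)) = rev [seq h%:R | h <- hs].
Proof.
have V := valid_height_wt; elim/heights_ind => [|{}hs b y r hh IH E1 E2].
  have := V [::] isT; rewrite /height_wt => v0.
  by rewrite /height_set /canonical_expr colength_sorted.
have := V _ hh; move: IH; rewrite /height_wt E1 E2 [size (_ :: _)]/= => IH vs.
by rewrite height_set_sorted // IH map_cons rev_cons.
Qed.

Lemma ht_height_wt hs : heights hs -> ht (wof (height_wt hs)) = (sumn hs)%:R.
Proof.
have V := valid_height_wt; elim/heights_ind => [|{}hs b y r hh IH E1 E2].
  by rewrite height_wt_nil wof_zeros htE raddf0.
have := V _ hh; move: IH; rewrite /height_wt E1 E2 [size (_ :: _)]/= => IH vs.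
by rewrite ht_sorted // IH /= natrD.
Qed.

(** Each head of [hs] is peeled off by one use of [shuffle_sum_lower], down to the zero weight,
    whose coefficient is 1. *)
Lemma shuffle_sum_height_wt hs : heights hs ->
  shuffle_sum (@fcoeff n) [::] (parts hs) (size hs) =
  \prod_(h <- hs) (fpsX ^+ h - 1).
Proof.
elim/heights_ind => [|{}hs b y r hh IH E1 E2].
  by rewrite big_nil shuffle_sum0 map_nseq cat0s fcoeff_zeros.
rewrite big_cons -IH E1 E2 [size (_ :: _)]/=.
apply: shuffle_sum_lower; [exact: fcoeff_swap0 | exact: fcoeff_swapS | exact: fcoeff_final_gt0].
Qed.

(** Otherwise the positive entry on the left would fall among the zeros on the right. *)
Lemma trailing_zeros b1 y1 r1 b2 y2 r2 :
  b1 ++ y1.+1 :: nseq r1 0%N = b2 ++ y2 :: nseq r2 0%N -> (r2 <= r1)%N.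
Proof.
move=> E; have szE := congr1 size E; rewrite !size_cat /= !size_nseq in szE.
rewrite leqNgt; apply/negP => lt; have := congr1 (fun s => nth 0%N s (size b1)) E.
rewrite nth_cat ltnn subnn /= nth_cat ltnNge.
have -> : (size b2 <= size b1)%N by lia.
have -> : (size b1 - size b2 = (size b1 - size b2).-1.+1)%N by lia.
by rewrite /= nth_nseq if_same.
Qed.

Lemma sumn_sorted_wt a N : valid (sorted_wt a N) -> (size a + N = n.+1)%N /\ sumn a = N.
Proof.
case/andP => /eqP; rewrite size_cat size_map size_nseq => sz.
rewrite big_cat /= big_map big_nseq => /eqP.
have -> : iter N (+%R (-1)) 0 = - N%:Z by elim: (N) => //= k ->; lia.
move=> E; split=> //; apply/eqP; rewrite -eqz_nat; apply/eqP.
move/eqP: E; rewrite subr_eq0 => /eqP <-.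
by elim: (a) => [|x s IH]; rewrite ?big_nil // big_cons -IH /= PoszD.
Qed.

Lemma parts_surj a N : valid (sorted_wt a N) ->
  exists hs, [/\ heights hs, size hs = N & parts hs = a].
Proof.
elim: N a => [|N IH] a va; have [sz sm] := sumn_sorted_wt va.
  exists [::]; split=> //; rewrite [LHS]/(nseq n.+1 0%N) -sz addn0; apply/esym/natnseq0P.
  by rewrite sm.
have := last_positive (a := a); rewrite sm => /(_ isT) [b [x [r E]]]; subst a.
have [hs [hh szh E]] := IH _ (valid_lower va).
exists (r.+1 :: hs); split; [|by rewrite /= szh|exact: parts_step].
have rn : (0 < r.+1 <= n)%N by move: sz; rewrite size_cat /= size_nseq; lia.
move: (hh); rewrite /heights => /andP[shs ahs].
rewrite /= in rn *; rewrite rn ahs !andbT.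
case: hs hh szh E shs ahs => // -[|h] hs hh _ E shs ahs; first by [].
rewrite /= in shs *; rewrite shs andbT.
(* The lowered weight has at least [r.+1] final zeros, while a list starting with [h.+1] leaves
   exactly [h] of them; hence r + 1 < h + 1 and the new list is increasing. *)
have [b' [y [_ E2]]] := parts_cons hh.
by move: E; rewrite E2 => /trailing_zeros; rewrite ltnS.
Qed.

Lemma quasi_dominant_heights lam : quasi_dominant lam ->
  exists2 hs, heights hs & lam = wof (height_wt hs).
Proof.
move=> /quasi_dominant_sorted[a [N [va ->]]].
have [hs [hh szh E]] := parts_surj va.
by exists hs; rewrite // /height_wt szh E.
Qed.

Lemma heights_quasi_dominant hs : heights hs -> quasi_dominant (wof (height_wt hs)).
Proof. by move=> /valid_height_wt; exact: sorted_quasi_dominant. Qed.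

Lemma fsum_height_orbit hs : heights hs ->
  \sum_(mu \in local_orbit (wof (height_wt hs))) kcoef mu = \prod_(h <- hs) (fpsX ^+ h - 1).
Proof.
move=> hh; have vs := valid_height_wt hh.
rewrite fsum_local_orbit // -shuffle_sum_height_wt // /shuffle_sum.
apply: eq_big_seq => s sin /=; rewrite /fcoeff.
by rewrite (@perm_valid n _ _ (shuffle_perm sin)) -/(height_wt _) vs.
Qed.

End CanonicalExpression.

(** * Subsets as subsequences *)

Fixpoint subsequences (T : Type) (s : seq T) : seq (seq T) :=
  if s is x :: s' then subsequences s' ++ map (cons x) (subsequences s') else [:: [::]].

Lemma mem_subsequences (T : eqType) (s u : seq T) : (u \in subsequences s) = subseq u s.
Proof.
elim: s u => [|x s IH] u; first by rewrite mem_seq1; case: u.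
rewrite mem_cat IH; case: u => [|y u]; first by rewrite !sub0seq.
have -> : (y :: u \in map (cons x) (subsequences s)) = (y == x) && subseq u s.
  apply/mapP/andP => [[w + [-> ->]]|[/eqP -> us]]; first by rewrite IH eqxx.
  by exists u; rewrite ?IH.
rewrite [RHS]/=; case: eqP => _; last by rewrite orbF.
rewrite -[subseq (y :: u) s || _]/(subseq (y :: u) s || subseq u s) orb_idl // => yus.
exact: subseq_trans (subseq_cons u y) yus.
Qed.

Lemma subsequences_uniq (T : eqType) (s : seq T) : uniq s -> uniq (subsequences s).
Proof.
elim: s => //= x s IH /andP[xs us]; rewrite cat_uniq map_inj_uniq ?IH //; last by move=> ? ? [].
rewrite andbT /=; apply/hasPn => _ /mapP[w _ ->]; rewrite mem_subsequences.
by apply: contraNN xs => /mem_subseq; apply; rewrite inE eqxx.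
Qed.

(** Expansion of the product of the factors 1 + (F x - 1). *)
Lemma sum_subsequences_prod (R : comNzRingType) (T : Type) (s : seq T) (F : T -> R) :
  \sum_(u <- subsequences s) \prod_(x <- u) (F x - 1) = \prod_(x <- s) F x.
Proof.
elim: s => [|x s IH]; first by rewrite big_seq1 !big_nil.
rewrite big_cat big_map /= [RHS]big_cons -IH.
under [X in _ + X]eq_bigr => u _ do rewrite big_cons.
by rewrite -mulr_sumr mulrBl mul1r addrC subrK.
Qed.

Lemma subset_ltn_sorted_subseq (s u : seq nat) :
  sorted ltn s -> sorted ltn u -> {subset u <= s} -> subseq u s.
Proof.
move=> ss su us; have -> : u = [seq x <- s | x \in u].
  apply: (irr_sorted_eq ltn_trans ltnn) => //; first exact: sorted_filter ltn_trans _ _ ss.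
  by move=> x; rewrite mem_filter; case: (boolP (x \in u)) => // /us ->.
exact: filter_subseq.
Qed.

(** * The scalar product with 1 *)

Section ScalarProduct.
Variable n : nat.
Local Notation K := {fraction {poly rat}}.
Implicit Types g h : {galg K[weight n]}.

Lemma scalar_product1E (d : {fset weight n}) g : (msupp (gbar g) `<=` d)%fset ->
  scalar_product 1 g = \sum_(k <- d) laurent (gbar g)@_k *
    FracField.tofrac (map_fps (@torus_int rat n) (fpsC (gexp k) * cherednik_kernel n)).
Proof.
move=> gd; rewrite /scalar_product mul1r; apply: big_fset_incl => // k _ /mcoeff_outdom ->.
by rewrite raddf0 mul0r.
Qed.

Lemma scalar_product1D g h :
  scalar_product 1 (g + h) = scalar_product 1 g + scalar_product 1 h.
Proof.
have E : gbar (g + h) = gbar g + gbar h.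
  by apply/malgP => k; rewrite gbarE [LHS]mcoeffD [RHS]mcoeffD; congr (_ + _); rewrite gbarE.
have sub : (msupp (gbar (g + h)%R) `<=` msupp (gbar g) `|` msupp (gbar h))%fset.
  by rewrite E; exact: msuppD_le.
rewrite (scalar_product1E sub) (scalar_product1E (fsubsetUl _ (msupp (gbar h)))).
rewrite (scalar_product1E (fsubsetUr (msupp (gbar g)) _)) -big_split /=.
by apply: eq_bigr => k _; rewrite E mcoeffD raddfD mulrDl.
Qed.

Lemma scalar_product10 : scalar_product 1 (0 : {galg K[weight n]}) = 0.
Proof.
have E : gbar (0 : {galg K[weight n]}) = 0 by apply/malgP => k; rewrite gbarE !mcoeff0.
by rewrite /scalar_product mul1r E msupp0 big_seq_fset0.
Qed.

(** Conjugation turns e^mu into e^(-mu), and the constant term of e^(-mu) C(t) is the coefficient of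
    C(t) at mu. *)
Lemma scalar_product1_gexp (mu : weight n) :
  scalar_product 1 (gexp mu : {galg K[weight n]}) = FracField.tofrac (kcoef mu).
Proof.
have E : gbar (gexp mu : {galg K[weight n]}) = << 1 *g - mu >>.
  by apply/malgP => k; rewrite gbarE !mcoeffU eqr_oppLR.
rewrite /scalar_product mul1r E msuppU oner_eq0 big_seq_fset1 mcoeffUU rmorph1 mul1r.
congr FracField.tofrac.
rewrite -[map_fps _ _]/(fps_mcoeff 0 (fpsC (gexp (- mu)) * cherednik_kernel n)).
by rewrite fps_mcoeff_gexpM sub0r opprK.
Qed.

Lemma scalar_product1_qmonomial hs : heights n hs ->
  scalar_product 1 (qmonomial K (wof n (height_wt n hs))) =
  FracField.tofrac (\prod_(h <- hs) (fpsX ^+ h - 1)).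
Proof.
move=> hh; have vs := valid_height_wt hh.
transitivity (FracField.tofrac (\sum_(s <- shuffle (parts n hs) (size hs)) kcoef (wof n s))).
  rewrite /qmonomial fsum_local_orbit //.
  rewrite (big_morph _ scalar_product1D scalar_product10) rmorph_sum.
  by apply: eq_bigr => s _; exact: scalar_product1_gexp.
congr FracField.tofrac; rewrite -(fsum_local_orbit _ vs).
exact: fsum_height_orbit.
Qed.

Lemma qsub_heights hs hs' : heights n hs -> heights n hs' ->
  qsub (wof n (height_wt n hs)) (wof n (height_wt n hs')) <-> subseq hs hs'.
Proof.
move=> hh hh'; rewrite /qsub !height_set_height_wt //.
have natI : injective (fun k : nat => k%:R : rat) by move=> a b /eqP; rewrite eqr_nat => /eqP.
split=> [sub|/mem_subseq sub x].
  move: (hh) (hh') => /andP[s1 _] /andP[s2 _]; apply: subset_ltn_sorted_subseq => // k kh.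
  have := sub k%:R; rewrite !mem_rev !(mem_map natI); exact.
by rewrite !mem_rev => /mapP[k /sub kh ->]; exact: map_f.
Qed.

Lemma heights_subseq hs hs' : subseq hs hs' -> heights n hs' -> heights n hs.
Proof.
move=> sub /andP[s a]; apply/andP; split; first exact: subseq_sorted ltn_trans _ _ sub s.
by apply/allP => x /(mem_subseq sub); exact: (allP a).
Qed.

Lemma height_wt_inj hs hs' : heights n hs -> heights n hs' ->
  wof n (height_wt n hs) = wof n (height_wt n hs') -> hs = hs'.
Proof.
move=> hh hh' /(congr1 (@height_set n)); rewrite !height_set_height_wt //.
by move=> /(can_inj revK)/inj_map; apply=> a b /eqP; rewrite eqr_nat => /eqP.
Qed.

(** Under the bijection with height sets [qsub] becomes inclusion, so the sum runs over the
    subsequences of [hs], which index distinct weights. *)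
Lemma fsum_qsub (V : nmodType) hs (F : weight n -> V) : heights n hs ->
  \sum_(mu \in [set mu | quasi_dominant mu /\ qsub mu (wof n (height_wt n hs))]%classic) F mu =
  \sum_(u <- subsequences hs) F (wof n (height_wt n u)).
Proof.
move=> hh; have hsub u : u \in subsequences hs -> heights n u.
  by rewrite mem_subsequences => /heights_subseq; apply.
have uW : uniq (map (fun u => wof n (height_wt n u)) (subsequences hs)).
  rewrite map_inj_in_uniq => [|u u' /hsub hu /hsub hu']; last exact: height_wt_inj.
  by apply: subsequences_uniq; case/andP: hh => /(sorted_uniq ltn_trans ltnn).
rewrite -(big_map (fun u => wof n (height_wt n u)) xpredT F) (fsbig_seq _ _ uW).
apply: eq_fsbigl; apply/seteqP; split=> mu /=.
  move=> [/quasi_dominant_heights[u hu ->] /(qsub_heights hu hh) sub].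
  by apply/mapP; exists u; rewrite ?mem_subsequences.
case/mapP => u uin ->; have hu := hsub u uin; split; first exact: heights_quasi_dominant.
by apply/qsub_heights; rewrite // -mem_subsequences.
Qed.

End ScalarProduct.

Lemma laurent_tvar : laurent tvar = FracField.tofrac fpsX.
Proof.
rewrite /tvar -[X in laurent X]divr1 -[1](rmorph1 (@FracField.tofrac _)) laurentE ?oner_eq0 //.
rewrite !rmorph1 divr1; congr FracField.tofrac; apply: fpsP => k /=.
by rewrite coefX.
Qed.

Theorem theorem1 (n : nat) (hn : (1 <= n)%N) (lam : weight n)
    (hlam : quasi_dominant lam) :
  scalar_product 1 (qfundamental {fraction {poly rat}} lam) =
  laurent (tvar ^ Num.floor (ht lam)).
Proof.
have [hs hh ->] := quasi_dominant_heights hlam.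
rewrite /qfundamental fsum_qsub //.
rewrite (big_morph _ (@scalar_product1D n) (@scalar_product10 n)).
transitivity (FracField.tofrac (\sum_(u <- subsequences hs) \prod_(h <- u) (fpsX ^+ h - 1))
    : {fraction {fps rat}}).
  rewrite rmorph_sum; apply: eq_big_seq => u; rewrite mem_subsequences => sub.
  exact/scalar_product1_qmonomial/heights_subseq/hh.
(* The height of [lam] is the sum of its height set, an integer, so the floor changes nothing. *)
have floorE : Num.floor ((sumn hs)%:R : rat) = (sumn hs)%:Z by rewrite pmulrn intrKfloor.
rewrite sum_subsequences_prod ht_height_wt // floorE -exprnP.
rewrite rmorphXn /= laurent_tvar -rmorphXn; congr FracField.tofrac.
by elim: {hh floorE} hs => [|h hs IH]; rewrite ?big_nil // big_cons IH -exprD.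
Qed.
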